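(* Assume $\diamondsuit_{\omega_1}$. Then there is a Hagendorf order $X\subseteq\mathbb{R}$ (with the order inherited from $\mathbb{R}$).
   Context: Work in ZFC. $\diamondsuit_{\omega_1}$ is the statement that there is a sequence $\langle A_\alpha:\alpha<\omega_1\rangle$ with $A_\alpha\subseteq\alpha$ such that for every $A\subseteq\omega_1$ the set $\{\alpha<\omega_1: A\cap\alpha=A_\alpha\}$ is stationary in $\omega_1$. For linear orders or order types, $\varphi\le\psi$ means $\varphi$ embeds into $\psi$ by a strictly order-preserving map, and $\varphi<\psi$ means $\varphi\le\psi$ and $\psi\not\le\varphi$. The sum $\varphi+\psi$ places a copy of $\psi$ after a copy of $\varphi$. A type $\tau$ is strictly indecomposable to the right if whenever $\tau=\varphi+\psi$ with $\psi>0$ (i.e. $\psi$ non-empty), then $\varphi<\tau$ and $\tau\le\psi$. An order type $\varphi$ is Hagendorf if (1) $\varphi$ is strictly indecomposable to the right, (2) for every order type $\psi$, $\psi<\varphi$ implies $\psi+1\le\varphi$, and (3) $\varphi$ is not the type of an ordinal. A linear order is a Hagendorf order if its type is Hagendorf. *)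

(* Defs.v *)
From HB Require Import structures.
From mathcomp Require Import all_boot all_order all_algebra.
From mathcomp Require Import all_classical wochoice all_reals.

Set Implicit Arguments.
Unset Strict Implicit.
Unset Printing Implicit Defensive.

Import Order.TTheory.

Local Open Scope classical_set_scope.
Local Open Scope order_scope.

(* Linear orders are MathComp [orderType]s.  Since [gen_choiceMixin] makes every
   type a [choiceType], this covers all linear orders, including the empty one.
   Order types are represented by orders; the notions below are all invariant
   under isomorphism. *)

Definition embeds d1 (P : orderType d1) d2 (Q : orderType d2) : Prop :=
  exists f : P -> Q, {homo f : x y / x < y}.

Definition strictly_embeds d1 (P : orderType d1) d2 (Q : orderType d2) : Prop :=
  embeds P Q /\ ~ embeds Q P.

Definition order_isomorphic d1 (P : orderType d1) d2 (Q : orderType d2) : Prop :=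
  exists2 f : P -> Q, bijective f & {mono f : x y / x < y}.

Definition osum d1 (P : orderType d1) d2 (Q : orderType d2) : Type := (P + Q)%type.

Fact osum_display : Order.disp_t. Proof. exact: Order.default_display. Qed.

Section OrderSum.
Context d1 (P : orderType d1) d2 (Q : orderType d2).
Implicit Types x y z : osum P Q.

HB.instance Definition _ := Choice.on (osum P Q).

Definition osum_le x y : bool :=
  match x, y with
  | inl p, inl p' => p <= p'
  | inr q, inr q' => q <= q'
  | inl _, inr _ => true
  | inr _, inl _ => false
  end.

Fact osum_le_refl : reflexive osum_le.
Proof. by case=> ? /=. Qed.

Fact osum_le_anti : antisymmetric osum_le.
Proof. by case=> a [] b //= /le_anti ->. Qed.

Fact osum_le_trans : transitive osum_le.
Proof. by case=> b [] a [] c //=; apply: le_trans. Qed.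

Fact osum_le_total : total osum_le.
Proof. by case=> a [] b //=; apply: le_total. Qed.

HB.instance Definition _ := Order.Le_isPOrder.Build osum_display (osum P Q)
  osum_le_refl osum_le_anti osum_le_trans.

HB.instance Definition _ := Order.POrder_isTotal.Build osum_display (osum P Q)
  osum_le_total.

End OrderSum.

(* The order inherited by a subset from the ambient linear order. *)
Section SubsetOrder.
Context d (T : orderType d) (X : set T).

HB.instance Definition _ := SubChoice.on (set_type X).
HB.instance Definition _ := [SubChoice_isSubOrder of set_type X by <: with d].

End SubsetOrder.

Definition strictly_indecomposable_right d (T : orderType d) : Prop :=
  forall d1 (P : orderType d1) d2 (Q : orderType d2),
    order_isomorphic T (osum P Q) -> [set: Q] !=set0 ->
    strictly_embeds P T /\ embeds T Q.

(* Up to isomorphism ordinals are exactly the well-orders. *)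
Definition is_ordinal_type d (T : orderType d) : Prop :=
  well_order (<=%O : rel T).

Definition hagendorf d (T : orderType d) : Prop :=
  [/\ strictly_indecomposable_right T,
      forall d1 (P : orderType d1),
        strictly_embeds P T -> embeds (osum P 'I_1) T
    & ~ is_ordinal_type T].

Definition initial_segment d (W : orderType d) (a : W) : set W :=
  [set b | b < a].

(* omega_1 up to isomorphism: the uncountable well-order with countable proper
   initial segments. *)
Definition is_omega1 d (W : orderType d) : Prop :=
  [/\ well_order (<=%O : rel W), ~ countable [set: W]
    & forall a : W, countable (initial_segment a)].

Definition unbounded d (W : orderType d) (C : set W) : Prop :=
  forall a : W, exists2 c, C c & a < c.

(* [a] is a nonzero limit point of [C], i.e. sup (C `&` a) = a. *)
Definition limit_point d (W : orderType d) (C : set W) (a : W) : Prop :=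
  initial_segment a !=set0 /\
  forall b : W, b < a -> exists2 c, C c & b < c < a.

Definition club d (W : orderType d) (C : set W) : Prop :=
  unbounded C /\ forall a : W, limit_point C a -> C a.

Definition stationary d (W : orderType d) (S : set W) : Prop :=
  forall C : set W, club C -> S `&` C !=set0.

Definition diamond_on d (W : orderType d) : Prop :=
  exists A : W -> set W,
    (forall a : W, A a `<=` initial_segment a) /\
    forall B : set W, stationary [set a | B `&` initial_segment a = A a].

Definition diamond_omega1 : Prop :=
  exists (d : Order.disp_t) (W : orderType d), is_omega1 W /\ diamond_on W.

(* Main.v *)
Require Import Defs.
From mathcomp Require Import all_boot all_order all_algebra.
From mathcomp Require Import all_classical all_reals.
From mathcomp Require Import lra.

Set Implicit Arguments.
Unset Strict Implicit.
Unset Printing Implicit Defensive.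

Import Order.TTheory GRing.Theory Num.Theory.

Local Open Scope classical_set_scope.
Local Open Scope order_scope.

(** The order is cut out of an increasing tower [A 0, A 1, ...] of sets of reals
with the following three properties.
- No increasing map sends [A n.+1] into [A n].
- Every [A n] has an increasing copy in the part of [A n.+1] inside any given
  interval.
- Dichotomy: if [Y] is included in the union of the tower and [k] is given,
  either some increasing map sends the part of [A k] in some interval into
  [Y], or [Y] has an increasing copy in the part of [A k] inside any given
  interval.
The Hagendorf order is the staircase of all [x] that lie in some [A n] with
[n < x].  Up to [m] it is included in [A m], and beyond [m] it contains a copy
of [A m.+1], so it does not embed in a proper initial segment.  Let [Y] be a
subset of the staircase.  If images of intervals of [A k] are found in [Y] for
all [k] and arbitrarily far to the right, then the staircase embeds in [Y], the
piece in [[n, n + 1)] being sent to the right of the previous pieces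
([rich_embeds]); final segments are of this kind.  Otherwise, for some [k] and
[b], the part of [Y] beyond [b] has a copy in a bounded interval of [A k] that
is part of the staircase, so [Y] embeds in a bounded part of the staircase and
there is room for one more point ([not_rich_bounded]).

The tower is built along [omega_1].  Fix disjoint countable dense sets [D j].
The set [D 0] stays out of the tower for ever; [A n] consists of
[D 1, ..., D n.+1] and of all points born during the recursion.  A stage [a]
adds an increasing continuous map [g a], which preserves [D 0] and the countable
set of points known so far, and possibly a new point, which is born together
with its images under all words in the maps [g b], [b <= a].  Every map added
later sends known points to known points, and every point born later is born
together with its images under the maps added before.  The invariant that
carries the proof is that words do not descend ([no_descent]): no word sends the
part of [A n.+1] in an interval into [A n].

This gives the first property, by the Baire category theorem
([killer_exists]).  An increasing [h] from [A n.+1] to [A n] agrees with no word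
on an interval.  So at a stage where a countable code of [h] is guessed there is
a point [x] such that the value which [h] is bound to take at [x] is neither
known nor an image of [x] under a word.  Then [x] is born and that value is
excluded for ever.

It gives the dichotomy too ([word_or_map]); here the guess has to be right at a
stage that reflects the situation.  If no word sends an interval of [A k] into [Y], there is a stage that
sees this with the words and the points available so far, and at which the known
part of [Y] is guessed.  At this stage [g a] is a generic increasing map
sending the known points of [Y] into [A k] and the other known points into
[D 0]; points of [Y] born later are mapped to points born later.

Words still do not descend after a generic map is added ([generic_map]).
Consider a word in which the new map is applied for the first time to [w x] with
[x] in [A n.+1].  If [k <= n.+1], some such [x] in [A k] has [w x] outside [Y],
so its image is in [D 0] and remains there.  If [n.+1 < k], either the image is
in [D 0] again or it may be any point of [A n.+1] in an interval; choosing it so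
that the next argument of the new map is fresh, one proceeds to the last step,
where the invariant for the earlier words provides a value outside [A n].

The second property is the dichotomy for [Y := A n] and [k := n.+1], since words
do not descend. *)

(** * Countable sets and stationary guessing on omega_1 *)

(** Choice with a default value, on types without a choice structure. *)
Definition pick_or T (x0 : T) (P : set T) : T :=
  if pselect (exists x, P x) is left h then projT1 (cid h) else x0.

Lemma pick_orP T (x0 : T) (P : set T) : (exists x, P x) -> P (pick_or x0 P).
Proof. by rewrite /pick_or; case: pselect => // h _; case: cid. Qed.

Lemma countable_enum T (A : set T) (x0 : T) : countable A -> A x0 ->
  exists e : nat -> T, (forall n, A (e n)) /\ forall x, A x -> exists n, e n = x.
Proof.
move=> /countable_injP[f finj] Ax0; pose P n x := A x /\ f x = n.
exists (fun n => pick_or x0 (P n)); split=> [n|x Ax].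
  have [/(pick_orP x0)[]//|nP] := pselect (exists x, P n x).
  by rewrite /pick_or; case: pselect.
exists (f x); have [Ay fy] := @pick_orP _ x0 (P (f x)) (ex_intro _ x (conj Ax erefl)).
by apply: finj => //; rewrite inE.
Qed.

Lemma countable_words (T : eqType) (A : set T) : countable A ->
  countable [set l : seq T | forall c, c \in l -> A c].
Proof.
move=> /countable_injP[f finj]; apply/countable_injP.
exists (fun l => pickle (map f l)) => l1 l2; rewrite !inE => Al1 Al2.
move/(pcan_inj pickleK); elim: l1 l2 Al1 Al2 => [|c l IH] [|c' l'] //= Al Al'.
move=> [fcc' ffl]; congr cons.
  by apply: finj => //; rewrite inE; [apply: Al|apply: Al']; rewrite mem_head.
by apply: IH => // b bl; [apply: Al|apply: Al']; rewrite inE bl orbT.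
Qed.

Section Omega1.
Context d (W : orderType d) (W1 : is_omega1 W).

Lemma omega1_min (A : set W) : A !=set0 ->
  exists m, A m /\ forall x, A x -> m <= x.
Proof.
move=> [x Ax]; have [wo _ _] := W1.
have [|m [[Am mle] _]] := wo [pred x | `[< A x >]].
  by exists x; apply/asboolP.
exists m; split; first exact/asboolP.
by move=> y Ay; apply: mle; apply/asboolP.
Qed.

Lemma omega1_wf : well_founded (fun a b : W => a < b).
Proof.
move=> a; apply: contrapT => na.
have [m [nm mle]] := omega1_min (ex_intro (fun x => ~ Acc _ x) a na).
apply: nm; constructor => b bm; apply: contrapT => nb.
by move: bm; rewrite ltNge (mle _ nb).
Qed.

Lemma omega1_below (a : W) : countable [set b | b < a].
Proof. by have [_ _] := W1; apply. Qed.

Lemma omega1_upto (a : W) : countable [set b | b <= a].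
Proof.
have -> : [set b | b <= a] =
    \bigcup_(i in [set: bool]) (if i then [set a] else [set b | b < a]).
  rewrite predeqE => b /=; split.
    by rewrite le_eqVlt => /orP[/eqP ->|ba]; [exists true|exists false].
  by move=> [[] _ /=]; [move=> -> |move/ltW].
by apply: bigcup_countable => // -[] _; [apply: countable1|apply: omega1_below].
Qed.

Lemma countable_bounded (A : set W) : countable A ->
  exists b, forall a, A a -> a < b.
Proof.
move=> cA; apply: contrapT => nb; have [_ + _] := W1; apply.
have -> : [set: W] = \bigcup_(a in A) [set b | b <= a].
  rewrite predeqE => b; split => // _; apply: contrapT => nab.
  apply: nb; exists b => a Aa; rewrite ltNge; apply/negP => ba.
  by apply: nab; exists a.
by apply: bigcup_countable => // a _; apply: omega1_upto.
Qed.

(** Transfinite recursion in relational form.  A stage may speak about its own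
value, so a stage consisting of several successive choices is a single
relation, and the relations already satisfied are available when the next
value has to be found. *)
Lemma stage_recursion V (v0 : V) (Rel : W -> (W -> V) -> Prop) :
  (forall a F F', (forall b, b <= a -> F b = F' b) -> Rel a F -> Rel a F') ->
  (forall a F, (forall b, b < a -> Rel b F) ->
    exists v, Rel a (fun b => if b == a then v else F b)) ->
  exists F, forall a, Rel a F.
Proof.
move=> RelE RelS.
pose ext (a : W) (f : forall b : W, b < a -> V) (b : W) :=
  if pselect (b < a) is left h then f b h else v0.
pose step (a : W) (f : forall b : W, b < a -> V) :=
  pick_or v0 [set v | Rel a (fun b => if b == a then v else ext a f b)].
pose F := Fix omega1_wf (fun=> V) step.
have FE a : F a = step a (fun b _ => F b).
  apply: Fix_eq => x f g fg; rewrite /step; congr pick_or.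
  suff -> : ext x f = ext x g by [].
  by apply: funext => b; rewrite /ext; case: pselect.
exists F; apply: (well_founded_ind omega1_wf) => a IH.
have [|v Rv] := RelS a (ext a (fun b _ => F b)).
  move=> b ba; apply: RelE (IH _ ba) => c cb; rewrite /ext.
  by case: pselect => // -[]; apply: le_lt_trans ba.
have : Rel a (fun b => if b == a then F a else ext a (fun b _ => F b) b).
  by rewrite FE; apply: (pick_orP v0 (P := [set v | Rel a (fun b =>
    if b == a then v else ext a (fun b _ => F b) b)])); exists v.
apply: RelE => b; rewrite le_eqVlt; case: eqP => [->//|_ /= ba].
by rewrite /ext; case: pselect.
Qed.

(** Countably many closing-off steps, starting anywhere, end at a closure point:
the least upper bound of the sequence, which exists since countable sets are
bounded. *)
Lemma closure_club (phi : W -> W) :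
  club [set a | (exists b, b < a) /\ forall b, b < a -> phi b < a].
Proof.
split=> [a|a [aN0 alim]]; last first.
  split=> // b ba.
  by have [c [_ Cc] /andP[bc]] := alim _ ba; apply: lt_trans (Cc _ bc).
have nxt (c : W) : exists c', c < c' /\ forall b, b <= c -> phi b < c'.
  have [|c' c'P] := @countable_bounded (\bigcup_(b in [set b | b <= c]) [set b; phi b]).
    apply: bigcup_countable; first exact: omega1_upto.
    by move=> b _; apply: finite_set_countable; apply: finite_set2.
  exists c'; split; first by apply: c'P; exists c => /=; [|left].
  by move=> b bc; apply: c'P; exists b => //; right.
have [s sP] := choice nxt.
pose a_ n := iter n s a.
have [|b0 b0P] := @countable_bounded (range a_); first exact: card_image_le.
have [c [cP cle]] := omega1_min (ex_intro (fun c => forall n, a_ n < c) b0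
  (fun n => b0P _ (ex_intro2 _ _ n I erefl))).
exists c; last exact: (cP 0%N).
split; first by exists (a_ 0%N).
move=> b bc; have [n] : exists n, b <= a_ n.
  apply: contrapT => nb; move: bc; rewrite ltNge cle // => n.
  by rewrite ltNge; apply/negP => ?; apply: nb; exists n.
by move=> /(proj2 (sP _)) /lt_trans; apply; apply: (cP n.+1).
Qed.

(** Each row of the pairing map is injective and avoids the countably many values
already used, by recursion on the first argument. *)
Lemma omega1_pairing : exists pi : W -> nat -> W,
  forall a m b n, pi a m = pi b n -> a = b /\ m = n.
Proof.
have [_ Wunc _] := W1.
have [w0 _] : exists w : W, True.
  apply: contrapT => nw; apply: Wunc.
  suff -> : [set: W] = set0 by apply: countable0.
  by rewrite predeqE => w; split => // _; apply: nw; exists w.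
pose Rel a (F : W -> nat -> W) := (forall m n, F a m = F a n -> m = n) /\
  forall b, b < a -> forall m n, F a m <> F b n.
have [||pi piP] := @stage_recursion (nat -> W) (fun=> w0) Rel.
- move=> a F F' FF' [injF disjF]; split=> [m n|b ba m n].
    by rewrite -FF' //; apply: injF.
  by move: (disjF b ba m n); rewrite (FF' a) ?(FF' b) ?(ltW ba).
- move=> a F _; pose U := \bigcup_(b in [set b | b < a]) range (F b).
  have Ucount : countable U.
    apply: bigcup_countable; first exact: omega1_below.
    by move=> b _; apply: card_image_le.
  have : infinite_set (~` U).
    move=> /finite_set_countable cU; apply: Wunc.
    have -> : [set: W] = \bigcup_(i in [set: bool]) (if i then U else ~` U).
      rewrite predeqE => b; split => // _.
      by have [|] := pselect (U b); [exists true|exists false].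
    by apply: bigcup_countable => // -[].
  move=> /infiniteP/card_leP[f]; exists (fun n => set_val (f (to_setT n))).
  rewrite /Rel eqxx; split=> [m n /val_inj/inj|b ba m n].
    by rewrite !inE => /(_ I I) [].
  rewrite (lt_eqF ba) => fF.
  move: fF; case: (f _) => x xU xF'.
  have {xF'}xF : x = F b n := xF'.
  by move/set_mem: xU; apply; rewrite xF; exists b => //; exists n.
exists pi => a m b n ab.
have [ltab|ltba|eab] := ltgtP a b.
- by have [_ /(_ _ ltab n m)] := piP b; rewrite ab.
- by have [_ /(_ _ ltba m n)] := piP a; rewrite ab.
- by move: ab; rewrite eab => /(proj1 (piP b)).
Qed.

(** The guessing principle in the form used below.  Countable sets [T b] of
points are produced along the recursion; a subset [Y] of their union and a set
[M] of integers are coded by the subset of [W] consisting of the pairs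
[(b, code of a point of T b in Y)] and [(b, element of M)], moved into [W] by
the pairing map.  At a stage closed under the pairing map the guess for that
subset can be decoded from the part of [T] built so far. *)
Lemma diamond_guess (X : Type) : diamond_on W ->
  exists (gset : (W -> set X) -> W -> set X) (gcode : W -> set nat),
  (forall T T' a, (forall b, b < a -> T b = T' b) -> gset T a = gset T' a) /\
  forall T, (forall b, countable (T b)) ->
  forall (Y : set X) (M : set nat) (phi : W -> W), exists a,
    [/\ exists b, b < a, forall b, b < a -> phi b < a,
        forall b x, b < a -> T b x -> (gset T a x <-> Y x) & gcode a = M].
Proof.
move=> [A [_ Aguess]]; have [pi piI] := omega1_pairing.
pose inj_on (P : set X) (f : X -> nat) :=
  forall x y, P x -> P y -> f x = f y -> x = y.
(* One fixed numbering of each countable set, so that the decoding of a stage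
   depends on the sets [T b] only. *)
pose f P := pick_or (fun=> 0%N) (inj_on P).
have fP P : countable P -> inj_on P (f P).
  move=> /countable_injP[g ginj]; apply: pick_orP; exists g => x y Px Py.
  by apply: ginj; rewrite inE.
exists (fun T a => [set x | exists b, [/\ b < a, T b x & A a (pi b (f (T b) x).*2)]]).
exists (fun a => [set i | exists b, b < a /\ A a (pi b i.*2.+1)]).
split=> [T T' a TT'|T Tcount Y M phi].
  rewrite predeqE => x; split=> -[b [ba Tbx Ab]]; exists b.
    by rewrite -!TT'.
  by rewrite !TT'.
have bnd b : exists c, phi b < c /\ forall n, pi b n < c.
  have [|c cP] := @countable_bounded (\bigcup_(i in [set: bool])
      if i then [set phi b] else range (pi b)).
    apply: bigcup_countable => // -[] _; first exact: countable1.
    exact: card_image_le.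
  exists c; split; first by apply: cP; exists true.
  by move=> n; apply: cP; exists false => //; exists n.
have [psi psiP] := choice bnd.
pose B : set W := [set w | (exists b x, [/\ T b x, Y x & w = pi b (f (T b) x).*2])
  \/ exists b i, M i /\ w = pi b i.*2.+1].
have [a [/= Ba [aN0 acl]]] := Aguess B _ (closure_club psi).
have AB b n : b < a -> A a (pi b n) <-> B (pi b n).
  move=> ba; rewrite -Ba; split; first by case.
  by move=> Bb; split=> //; apply: lt_trans (acl _ ba); case: (psiP b).
exists a; split=> //.
- by move=> b ba; apply: lt_trans (acl _ ba); case: (psiP b).
- move=> b x ba Tbx; split=> [[b' [b'a Tx] /(AB _ _ b'a)]|Yx].
    move=> [[c [y [Ty Yy /piI[]]]]|[c [i [_ /piI[_]]]]]; last first.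
      by move=> /(congr1 odd); rewrite /= !odd_double.
    move=> bc /double_inj fxy; subst c.
    by rewrite (fP _ (Tcount b') _ _ Tx Ty fxy).
  exists b; split=> //; apply/AB => //; left.
  by exists b, x.
- rewrite predeqE => i; split=> [[b [ba /(AB _ _ ba)]]|Mi].
    move=> [[c [y [_ _ /piI[_]]]]|[c [j [Mj /piI[_]]]]].
      by move=> /(congr1 odd); rewrite /= !odd_double.
    by move=> [/double_inj ->].
  case: aN0 => b ba; exists b; split=> //; apply/AB => //; right.
  by exists b, i.
Qed.

End Omega1.

(** * Monotone maps of the real line *)

Section RealMaps.
Local Open Scope ring_scope.
Context (R : realType).
Implicit Types (f g w : R -> R) (A B : set R) (x y p q : R).

Definition increasing f := {homo f : x y / x < y}.

(** Two-sided continuity of a monotone map, in terms of the order only. *)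
Definition order_continuous f := forall x c,
  (c < f x -> exists y, y < x /\ c < f y) /\
  (f x < c -> exists y, x < y /\ f y < c).

Definition order_dense A := forall p q, p < q -> exists x, A x /\ p < x < q.

Definition nowhere_dense B := forall p q, p < q -> exists p' q',
  [/\ p <= p', p' < q', q' <= q & forall x, p' < x < q' -> ~ B x].

Lemma increasing_lt f x y : increasing f -> (f x < f y) = (x < y).
Proof. by move=> fi; rewrite (leW_mono (le_mono fi)). Qed.

Lemma increasing_inj f : increasing f -> injective f.
Proof. by move=> /le_mono/inc_inj. Qed.

Lemma increasing_comp f g : increasing f -> increasing g -> increasing (f \o g).
Proof. by move=> fi gi x y /gi/fi. Qed.

Lemma order_continuous_comp f g : increasing f ->
  order_continuous f -> order_continuous g -> order_continuous (f \o g).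
Proof.
move=> fi fc gc x c; split=> /=.
  move=> /(proj1 (fc _ _))[y [/(proj1 (gc _ _))[z [zx /fi yz]] cy]].
  by exists z; split=> //=; apply: lt_trans yz.
move=> /(proj2 (fc _ _))[y [/(proj2 (gc _ _))[z [zx /fi yz]] cy]].
by exists z; split=> //=; apply: lt_trans cy.
Qed.

(** The Baire category theorem for the line, in a form where only the endpoints of
nested intervals matter. *)
Lemma baire_intervals (B : nat -> set R) : (forall i, nowhere_dense (B i)) ->
  forall p q, p < q -> exists x, p < x < q /\ forall i, ~ B i x.
Proof.
move=> Bnd p q pq.
have shrink (iu : nat * (R * R)) : exists v : R * R, iu.2.1 < iu.2.2 ->
    [/\ iu.2.1 < v.1, v.1 < v.2, v.2 < iu.2.2 &
        forall x, v.1 <= x <= v.2 -> ~ B iu.1 x].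
  case: iu => i [a b] /=; have [ab|] := boolP (a < b); last by exists (a, b).
  have [a' [b' [aa' ab' bb' nB]]] := Bnd i a b ab.
  exists ((a' + a' + b') / 3, (a' + b' + b') / 3) => _ /=.
  split; try lra.
  by move=> x /andP[x1 x2]; apply: nB; apply/andP; split; lra.
have [s sP] := choice shrink.
pose u := fix u n := if n is n'.+1 then s (n', u n') else (p, q).
have ult n : (u n).1 < (u n).2 by elim: n => //= n /(sP (n, u n))[].
have u1 n : (u n).1 < (u n.+1).1 by case: (sP (n, u n) (ult n)).
have u2 n : (u n.+1).2 < (u n).2 by case: (sP (n, u n) (ult n)).
have u12 m n : (u m).1 < (u n).2.
  have m1 k : (u m).1 <= (u (m + k)%N).1.
    by elim: k => [|k IH]; rewrite ?addn0 // addnS (le_trans IH) // ltW.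
  have n2 k : (u (n + k)%N).2 <= (u n).2.
    by elim: k => [|k]; rewrite ?addn0 // addnS; apply: le_trans; rewrite ltW.
  by apply: le_lt_trans (m1 n) _; rewrite addnC; apply: lt_le_trans (n2 m).
pose x := sup (range (fun n => (u n).1)).
have hs : has_sup (range (fun n => (u n).1)).
  split; first by exists (u 0%N).1; exists 0%N.
  by exists (u 0%N).2 => _ [n _ <-]; rewrite ltW.
have x1 n : (u n).1 <= x by apply: sup_upper_bound => //; exists n.
have x2 n : x <= (u n).2.
  by apply: ge_sup => [|_ [m _ <-]]; [case: hs|rewrite ltW].
exists x; split=> [|i].
  by apply/andP; split; [apply: lt_le_trans (u1 0%N) _|apply: le_lt_trans (u2 0%N)].
by case: (sP (i, u i) (ult i)) => _ _ _; apply; rewrite (x1 i.+1) (x2 i.+1).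
Qed.

(** Small sets occurring below often are preimages of a point under an injective
map; one half of any interval avoids such a set. *)
Lemma nowhere_dense_sub1 B : (forall x y, B x -> B y -> x = y) -> nowhere_dense B.
Proof.
move=> B1 p q pq; pose m := (p + q) / 2.
have [[x [Bx /andP[px xm]]]|nB] := pselect (exists x, B x /\ p < x < m).
  exists m, q; split=> //; rewrite /m; try lra.
  by move=> y /andP[my _] /(B1 _ _ Bx) xy; move: my; rewrite -xy ltNge ltW.
exists p, m; split=> //; rewrite /m; try lra.
by move=> x xpm Bx; apply: nB; exists x.
Qed.

(** A strictly increasing correspondence with dense domain and with range dense
in [(a, b)] has no room for a jump, so the supremum formula extends it to a
continuous map. *)
Lemma extend_increasing (F : R -> R -> Prop) a b :
  (forall s t s' t', F s t -> F s' t' -> (s < s') = (t < t')) ->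
  order_dense [set s | exists t, F s t] ->
  (forall p q, p < q -> a <= p -> q <= b -> exists s t, F s t /\ p < t < q) ->
  (forall s t, F s t -> a < t < b) ->
  exists g, [/\ increasing g, order_continuous g, forall x, a < g x < b &
    forall s t, F s t -> g s = t].
Proof.
move=> Fmono Fdom Fran Fab.
pose E x := [set t | exists s, s <= x /\ F s t].
pose g x := sup (E x).
have Edom p q : p < q -> exists s t, F s t /\ p < s < q.
  by move=> /Fdom[s [[t Fst] spq]]; exists s, t.
have hs x : has_sup (E x).
  split; last by exists b => t [s [_ /Fab/andP[_ /ltW]]].
  have [|s [t [Fst /andP[_ sx]]]] := Edom (x - 1) x; first lra.
  by exists t; exists s; rewrite ltW.
have gub s t x : F s t -> x < s -> g x <= t.
  move=> Fst xs; apply: ge_sup => [|t' [s' [s'x Fs't']]]; first by case: (hs x).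
  by rewrite ltW // -(Fmono _ _ _ _ Fs't' Fst) (le_lt_trans s'x).
have glb s t x : F s t -> s <= x -> t <= g x.
  by move=> Fst sx; apply: sup_upper_bound => //; exists s.
have gE s t : F s t -> g s = t.
  move=> Fst; apply/le_anti; rewrite (glb _ _ _ Fst (lexx s)) andbT.
  apply: ge_sup => [|t' [s' [s's Fs't']]]; first by case: (hs s).
  by rewrite leNgt -(Fmono _ _ _ _ Fst Fs't') -leNgt.
have gi : increasing g.
  move=> x y xy; have [s [t [Fst /andP[xs sy]]]] := Edom _ _ xy.
  have [s' [t' [Fst' /andP[ss' s'y]]]] := Edom _ _ sy.
  apply: le_lt_trans (gub _ _ _ Fst xs) _.
  apply: lt_le_trans (glb _ _ _ Fst' (ltW s'y)).
  by rewrite -(Fmono _ _ _ _ Fst Fst').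
have gab x : a < g x < b.
  have [|s [t [Fst /andP[_ sx]]]] := Edom (x - 1) x; first lra.
  have [|s' [t' [Fst' /andP[s'x _]]]] := Edom x (x + 1); first lra.
  have /andP[at_ _] := Fab _ _ Fst; have /andP[_ tb] := Fab _ _ Fst'.
  rewrite (lt_le_trans at_ (glb _ _ _ Fst (ltW sx))) /=.
  exact: le_lt_trans (gub _ _ _ Fst' s'x) tb.
exists g; split=> // x c; have /andP[agx gxb] := gab x; split=> cg.
  have [|||s [t [Fst /andP[ct tg]]]] := Fran (Num.max a c) (g x).
  - by rewrite gt_max agx.
  - by rewrite le_max lexx.
  - exact: ltW.
  exists s; rewrite (gE _ _ Fst); split; last first.
    by move: ct; rewrite gt_max => /andP[].
  by rewrite -(increasing_lt _ _ gi) (gE _ _ Fst).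
have [|||s [t [Fst /andP[gt tc]]]] := Fran (g x) (Num.min b c).
- by rewrite lt_min gxb.
- exact: ltW.
- by rewrite ge_min lexx.
exists s; rewrite (gE _ _ Fst); split; last first.
  by move: tc; rewrite lt_min => /andP[].
by rewrite -(increasing_lt _ _ gi) (gE _ _ Fst).
Qed.

End RealMaps.

(** * Generic increasing maps *)

Section Generic.
Local Open Scope ring_scope.
Context (R : realType).
Implicit Types (P Q : seq (R * R)) (s t x y z p q : R).

Definition pairs_mono P := forall u v, u \in P -> v \in P ->
  (u.1 < v.1) = (u.2 < v.2).

(** The values allowed for a new argument [s] form a nonempty open interval: its
endpoints are values already taken on both sides of [s], or the given bounds. *)
Lemma pairs_gap P s a b : a < b -> pairs_mono P ->
  (forall u, u \in P -> a < u.2 < b) -> (forall u, u \in P -> u.1 <> s) ->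
  exists lo hi, [/\ a <= lo, lo < hi, hi <= b &
    forall t, lo < t < hi -> pairs_mono ((s, t) :: P)].
Proof.
move=> ab Pm Pab Ps.
(* The induction needs to know that the endpoints are values of the list or the
   given bounds; this is what keeps [lo < hi] when an endpoint moves. *)
have [lo [hi [[aLo lohi hib] [lomax himin _ _]]]] : exists lo hi,
    [/\ a <= lo, lo < hi & hi <= b] /\
    [/\ forall u, u \in P -> u.1 < s -> u.2 <= lo,
        forall u, u \in P -> s < u.1 -> hi <= u.2,
        lo = a \/ (exists u, [/\ u \in P, u.1 < s & u.2 = lo]) &
        hi = b \/ (exists u, [/\ u \in P, s < u.1 & u.2 = hi])].
  elim: P Pm Pab Ps => [|v P IH] Pm Pab Ps.
    by exists a, b; split; split=> //; left.
  have [u w uP wP|u uP|u uP|lo [hi [[alo lohi hib] [H1 H2 H3 H4]]]] := IH.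
  - by apply: Pm; rewrite inE ?uP ?wP orbT.
  - by apply: Pab; rewrite inE uP orbT.
  - by apply: Ps; rewrite inE uP orbT.
  have vP : v \in v :: P by rewrite mem_head.
  have sub u : u \in P -> u \in v :: P by rewrite inE => ->; rewrite orbT.
  have /andP[av vb] := Pab _ vP.
  have [vs|sv|] := ltgtP v.1 s; last by move=> /(Ps _ vP).
  - exists (Num.max lo v.2), hi; split.
      split; rewrite ?le_max ?alo // gt_max lohi /=.
      case: H4 => [->//|[u [uP su <-]]].
      by rewrite -(Pm _ _ vP (sub _ uP)) (lt_trans vs).
    split.
    + move=> u; rewrite inE le_max => /orP[/eqP ->|uP us]; first by rewrite lexx orbT.
      by rewrite (H1 _ uP us).
    + move=> u; rewrite inE => /orP[/eqP ->|]; last exact: H2.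
      by move=> /(lt_trans vs); rewrite ltxx.
    + have [vlo|lov] := leP v.2 lo.
        by case: H3 => [->|[u [uP us ulo]]]; [left|right; exists u; split; auto].
      by right; exists v.
    + by case: H4 => [->|[u [uP us ulo]]]; [left|right; exists u; split; auto].
  - exists lo, (Num.min hi v.2); split.
      split; rewrite ?ge_min ?hib // lt_min lohi /=.
      case: H3 => [->//|[u [uP su <-]]].
      by rewrite -(Pm _ _ (sub _ uP) vP) (lt_trans su).
    split.
    + move=> u; rewrite inE => /orP[/eqP ->|]; last exact: H1.
      by move=> /(lt_trans sv); rewrite ltxx.
    + move=> u; rewrite inE ge_min => /orP[/eqP ->|uP us]; first by rewrite lexx orbT.
      by rewrite (H2 _ uP us).
    + by case: H3 => [->|[u [uP us ulo]]]; [left|right; exists u; split; auto].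
    + have [hiv|vhi] := leP hi v.2.
        by case: H4 => [->|[u [uP us ulo]]]; [left|right; exists u; split; auto].
      by right; exists v.
exists lo, hi; split=> // t /andP[lot thi] u v.
rewrite !inE => /orP[/eqP ->|uP] /orP[/eqP ->|vP] /=; last exact: Pm.
- by rewrite !ltxx.
- have [sv|vs|] := ltgtP s v.1; last by move=> /esym/(Ps _ vP).
    by rewrite (lt_le_trans thi (himin _ vP sv)).
  by apply/esym/negbTE; rewrite -leNgt (le_trans (lomax _ vP vs)) // ltW.
- have [us|su|] := ltgtP u.1 s; last by move=> /(Ps _ uP).
    by rewrite (le_lt_trans (lomax _ uP us) lot).
  by apply/esym/negbTE; rewrite -leNgt (le_trans _ (himin _ uP su)) // ltW.
Qed.

Lemma seq_bounds (l : seq R) : exists lo hi, lo < hi /\ forall x, x \in l -> lo < x < hi.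
Proof.
elim: l => [|c l [lo [hi [lohi lP]]]]; first by exists 0%R, 1%R; split=> [|x]; rewrite ?in_nil ?ltr01.
exists (Num.min lo (c - 1)), (Num.max hi (c + 1)); split.
  by rewrite lt_max gt_min lohi.
move=> x; rewrite inE lt_max gt_min => /orP[/eqP ->|/lP/andP[-> ->]//].
by apply/andP; split; apply/orP; right; lra.
Qed.

Lemma avoid_finite (f : R -> R) (l : seq R) : injective f ->
  nowhere_dense [set x | f x \in l].
Proof.
move=> finj; elim: l => [|c l IH] p q pq; first by exists p, q.
have [p' [q' [pp' p'q' q'q H1]]] := IH _ _ pq.
have [|p2 [q2 [pp2 p2q2 q2q H2]]] := @nowhere_dense_sub1 _ [set x | f x = c] _ _ _ p'q'.
  by move=> x y <- /finj.
exists p2, q2; split; rewrite ?(le_trans pp') ?(le_trans q2q) // => x /andP[x1 x2].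
rewrite /= inE => /orP[/eqP|].
  by apply: H2; rewrite x1 x2.
by apply: H1; rewrite (le_lt_trans pp2) // (lt_le_trans x2).
Qed.

Lemma order_dense_avoid (A B : set R) p q : order_dense A -> nowhere_dense B ->
  p < q -> exists x, [/\ A x, p < x < q & ~ B x].
Proof.
move=> Ad Bnd /Bnd[p' [q' [pp' /Ad[x [Ax /andP[x1 x2]]] q'q nB]]].
exists x; split=> //; last by apply: nB; rewrite x1.
by rewrite (le_lt_trans pp') // (lt_le_trans x2).
Qed.

Fixpoint gword (e : nat -> R -> R) (g : R -> R) i0 (ws : seq nat) x :=
  if ws is w :: ws' then gword e g i0 ws' (g (e w x)) else e i0 x.

(** [run e P ws x v] computes [v] from [x] by the word [ws] where the finite set of
pairs [P] stands for the generic map; it determines the value of the word for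
every map extending [P]. *)
Fixpoint run (e : nat -> R -> R) P (ws : seq nat) x v : Prop :=
  if ws is w :: ws' then exists t, (e w x, t) \in P /\ run e P ws' t v else x = v.

Lemma gword_run e g P i0 ws x v : (forall u, u \in P -> g u.1 = u.2) ->
  run e P ws x v -> gword e g i0 ws x = e i0 v.
Proof.
by move=> gP; elim: ws x => [x ->//|w ws IH x [t [/gP /= -> /IH]]].
Qed.

Context (S Z : set R) (A : nat -> set R) (e : nat -> R -> R).
Context (Y : set R) (k : nat) (a b : R).
Context (ab : a < b) (Scount : countable S) (ZS : Z `<=` S)
  (AS : forall n, A n `<=` S) (AZ : forall n x, A n x -> ~ Z x)
  (Amono : forall m n, (m <= n)%N -> A m `<=` A n)
  (Ad : forall n, order_dense (A n)) (Zd : order_dense Z)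
  (einc : forall i, increasing (e i))
  (eS : forall i x, S x -> S (e i x)) (eZ : forall i x, Z x -> Z (e i x))
  (e_inv : forall i n p q, p < q ->
     exists x, [/\ A n.+1 x, p < x < q & ~ A n (e i x)])
  (small : forall i p q, p < q -> exists x, [/\ A k x, p < x < q & ~ Y (e i x)])
  (YZ : forall x, Y x -> ~ Z x).

(** Points of [Y] go to [A k], all other points to [Z]; the set [Z] absorbs what
must not be in [A n] for any [n]. *)
Definition valid s t := [/\ S s, a < t < b, Y s -> A k t & ~ Y s -> Z t].

Definition cond P := (forall u, u \in P -> valid u.1 u.2) /\ pairs_mono P.

Lemma cond_gap P s : cond P -> (forall u, u \in P -> u.1 <> s) ->
  exists lo hi, [/\ a <= lo, lo < hi, hi <= b &
    forall t, lo < t < hi -> valid s t -> cond ((s, t) :: P)].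
Proof.
move=> [Pv Pm] Ps.
have [|lo [hi [? ? ? H]]] := pairs_gap ab Pm _ Ps; first by move=> u /Pv[].
exists lo, hi; split=> // t tlo stv; split; last exact: H.
by move=> u; rewrite inE => /orP[/eqP ->|/Pv].
Qed.

Lemma subset_cons (u : R * R) P : {subset P <= u :: P}.
Proof. by move=> v; rewrite inE => ->; rewrite orbT. Qed.

Lemma cond_dom P s : cond P -> S s ->
  exists P' t, [/\ {subset P <= P'}, cond P' & (s, t) \in P'].
Proof.
move=> cP Ss; have [[u [uP us]]|nP] := pselect (exists u, u \in P /\ u.1 = s).
  by exists P, u.2; split=> //; rewrite -us -surjective_pairing.
have [|lo [hi [alo lohi hib H]]] := @cond_gap P s cP.
  by move=> u uP us; apply: nP; exists u.
have [t [tlo st]] : exists t, lo < t < hi /\ valid s t.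
  have [Ys|nYs] := pselect (Y s).
    have [t [At /andP[lot thi]]] := Ad k lohi.
    exists t; rewrite lot thi; split=> //; split=> //.
    by rewrite (le_lt_trans alo) // (lt_le_trans thi).
  have [t [Zt /andP[lot thi]]] := Zd lohi.
  exists t; rewrite lot thi; split=> //; split=> //.
  by rewrite (le_lt_trans alo) // (lt_le_trans thi).
by exists ((s, t) :: P), t; split; [exact: subset_cons|exact: H|exact: mem_head].
Qed.

(** Meeting all points of [Z] in the range makes the generic map continuous. *)
Lemma cond_ran P t : cond P -> Z t -> a < t < b ->
  exists P' s, [/\ {subset P <= P'}, cond P' & (s, t) \in P'].
Proof.
move=> cP Zt tab; have [[u [uP us]]|nP] := pselect (exists u, u \in P /\ u.2 = t).
  by exists P, u.1; split=> //; rewrite -us -surjective_pairing.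
have [Pv Pm] := cP; pose sw (u : R * R) := (u.2, u.1).
(* Arguments are unbounded, so arbitrary bounds of the finite list are used in
   the gap lemma for the inverse correspondence. *)
have [lo0 [hi0 [lohi0 bnd]]] := seq_bounds [seq u.1 | u <- P].
have [|||lo [hi [alo lohi hib H]]] := @pairs_gap (map sw P) t lo0 hi0 lohi0.
- by move=> _ _ /mapP[u uP ->] /mapP[v vP ->] /=; rewrite (Pm _ _ uP vP).
- by move=> _ /mapP[u uP ->] /=; apply: bnd; apply: map_f.
- by move=> _ /mapP[u uP ->] /= ut; apply: nP; exists u.
have [s [Zs slo]] := Zd lohi.
exists ((s, t) :: P), s; split; [exact: subset_cons| |exact: mem_head].
split=> [u|u v uP vP].
  rewrite inE => /orP[/eqP ->|/Pv //]; split=> //=; first exact: ZS.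
  by move=> /YZ.
by have /= -> := H _ slo (sw u) (sw v) (@map_f _ _ sw (_ :: P) _ uP)
  (@map_f _ _ sw (_ :: P) _ vP).
Qed.

(** Once in [Z] a computation remains in [Z], and a finite extension lets it
terminate. *)
Lemma cond_run_Z P ws z : cond P -> Z z ->
  exists P' v, [/\ {subset P <= P'}, cond P', Z v & run e P' ws z v].
Proof.
elim: ws P z => [|w ws IH] P z cP Zz; first by exists P, z; split.
have [P1 [t [PP1 cP1 tP1]]] := cond_dom cP (eS w (ZS Zz)).
have Zt : Z t.
  have [_ _ _ H] := proj1 cP1 _ tP1.
  by apply: H => Ywz; apply: (YZ Ywz); apply: eZ.
have [P2 [v [P12 cP2 Zv r]]] := IH _ _ cP1 Zt.
exists P2, v; split=> //; first by move=> u /PP1/P12.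
by exists t; split=> //; apply: P12.
Qed.

(** As long as the next argument is not yet in the domain, its value may be
chosen, within an interval, among the points of [A n.+1]; all such choices but
the last only have to keep the following argument fresh, and the last one is
made by the invariant of the family [e]. *)
Lemma cond_run_fresh n i0 ws w P x : (n.+1 <= k)%N -> cond P -> A n.+1 x ->
  (forall u, u \in P -> u.1 <> e w x) ->
  exists P' v, [/\ {subset P <= P'}, cond P', run e P' (w :: ws) x v & ~ A n (e i0 v)].
Proof.
move=> nk; elim: ws w P x => [|w' ws IH] w P x cP Ax xP.
all: have [lo [hi [alo lohi hib H]]] := cond_gap cP xP.
all: have Sx : S (e w x) by apply: eS; apply: AS Ax.
all: have tab t : lo < t < hi -> a < t < b by
  move=> /andP[t1 t2]; rewrite (le_lt_trans alo) // (lt_le_trans t2).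
all: have [Ywx|nYwx] := pselect (Y (e w x)).
- have [t [At tlo nAt]] := e_inv i0 n lohi.
  exists ((e w x, t) :: P), t; split=> //; first exact: subset_cons.
    by apply: H => //; split=> //; [exact: tab|move=> _; exact: Amono At].
  by exists t; rewrite mem_head.
- have [t [Zt tlo]] := Zd lohi.
  exists ((e w x, t) :: P), t; split=> //; first exact: subset_cons.
    by apply: H => //; split=> //; exact: tab.
    by exists t; rewrite mem_head.
  by move=> /AZ; apply; apply: eZ.
- have [t [At tlo tP]] := order_dense_avoid (@Ad n.+1)
    (@avoid_finite (e w') (e w x :: [seq u.1 | u <- P]) (increasing_inj (einc w'))) lohi.
  have cP1 : cond ((e w x, t) :: P).
    by apply: H => //; split=> //; [exact: tab|move=> _; exact: Amono At].
  have [u uP us|P' [v [PP' cP' r nA]]] := IH w' _ t cP1 At.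
    apply: tP; rewrite /= -us inE; move: uP; rewrite inE => /orP[/eqP ->|uP].
      by rewrite eqxx.
    by rewrite map_f ?orbT.
  exists P', v; split=> //; first by move=> u /(subset_cons (e w x, t))/PP'.
  by exists t; split=> //; apply: PP'; rewrite mem_head.
- have [t [Zt tlo]] := Zd lohi.
  have cP1 : cond ((e w x, t) :: P) by apply: H => //; split=> //; exact: tab.
  have [P' [v [PP' cP' Zv r]]] := cond_run_Z (w' :: ws) cP1 Zt.
  exists P', v; split=> //; first by move=> u /(subset_cons (e w x, t))/PP'.
    by exists t; split=> //; apply: PP'; rewrite mem_head.
  by move=> /AZ; apply; apply: eZ.
Qed.

Lemma cond_word n i0 ws p q P : cond P -> p < q -> exists P' x v,
  [/\ {subset P <= P'}, cond P' &
    [/\ A n.+1 x, p < x < q, run e P' ws x v & ~ A n (e i0 v)]].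
Proof.
move=> cP pq; case: ws => [|w ws].
  have [x [Ax xpq nA]] := e_inv i0 n pq.
  by exists P, x, x; split=> //; split.
(* If [k <= n.+1], leaving [Y] is enough.  If [n.+1 < k], values of the new map at
   points of [Y] may be chosen in [A n.+1], which is part of [A k]. *)
have [kn|nk] := leqP k n.+1.
  have [x [Ax xpq nY]] := small w pq.
  have Sx : S (e w x) by apply: eS; apply: AS Ax.
  have [P1 [t [PP1 cP1 tP1]]] := cond_dom cP Sx.
  have Zt : Z t by have [_ _ _ H] := proj1 cP1 _ tP1; apply: H.
  have [P2 [v [P12 cP2 Zv r]]] := cond_run_Z ws cP1 Zt.
  exists P2, x, v; split=> //; first by move=> u /PP1/P12.
  split=> //; first exact: Amono Ax.
    by exists t; split=> //; apply: P12.
  by move=> /AZ; apply; apply: eZ.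
have [x [Ax xpq xP]] := order_dense_avoid (@Ad n.+1)
  (@avoid_finite (e w) [seq u.1 | u <- P] (increasing_inj (einc w))) pq.
have [|P' [v [PP' cP' r nA]]] := @cond_run_fresh n i0 ws w P x (ltnW nk) cP Ax.
  by move=> u uP us; apply: xP; rewrite /= -us map_f.
by exists P', x, v.
Qed.

(** The map is the union of a chain of finite conditions meeting countably many
requirements. *)
Lemma generic_map : exists g, [/\ increasing g, order_continuous g,
    forall x, a < g x < b,
    [/\ forall x, S x -> S (g x), forall x, Z x -> Z (g x) &
        forall x, S x -> Y x -> A k (g x)] &
    forall i0 ws n p q, p < q ->
      exists x, [/\ A n.+1 x, p < x < q & ~ A n (gword e g i0 ws x)]].
Proof.
have [z0 [Zz0 _]] := Zd ab.
have [sE [sES sEP]] := countable_enum Scount (ZS Zz0).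
(* The requirements: the domain contains the i-th point of [S]; the range contains
   it if it belongs to [Z]; a word does not descend on a rational interval. *)
pose I := (nat + nat + (nat * seq nat * nat * (rat * rat)))%type.
pose D (i : I) P : Prop := match i with
  | inl (inl i) => exists t, (sE i, t) \in P
  | inl (inr i) => Z (sE i) -> a < sE i < b -> exists s, (s, sE i) \in P
  | inr (i0, ws, n, (p, q)) => (p < q)%R -> exists x v,
      [/\ A n.+1 x, ratr p < x < ratr q, run e P ws x v & ~ A n (e i0 v)] end.
have Dd i P : exists P', cond P -> [/\ {subset P <= P'}, cond P' & D i P'].
  have [cP|] := pselect (cond P); last by exists P.
  case: i => [[i|i]|[[[i0 ws] n] [p q]]] /=.
  - have [P' [t [? ? ?]]] := cond_dom cP (sES i).
    by exists P' => _; split=> //; exists t.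
  - have [[Zi iab]|nZ] := pselect (Z (sE i) /\ a < sE i < b).
      have [P' [s [? ? ?]]] := cond_ran cP Zi iab.
      by exists P' => _; split=> // _ _; exists s.
    by exists P => _; split=> // Zi iab; exfalso; apply: nZ.
  - have [pq|qp] := boolP (p < q)%R; last first.
      by exists P => _; split=> // pq; rewrite pq in qp.
    have [|P' [x [v [? ? ?]]]] := @cond_word n i0 ws (ratr p) (ratr q) P cP.
      by rewrite ltr_rat.
    by exists P' => _; split=> // _; exists x, v.
have [nx nxP] := choice (fun iP : I * seq (R * R) => Dd iP.1 iP.2).
pose u := fix u m := if m is m'.+1 then
  (if unpickle m' is Some i then nx (i, u m') else u m') else [::].
have cu m : cond (u m).
  elim: m => [|m IH] //=; case: unpickle => // i.
  by have [] := nxP (i, u m) IH.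
have uS m : {subset u m <= u m.+1}.
  move=> v /=; case: unpickle => // i; by have [/(_ v)] := nxP (i, u m) (cu m).
have usub m n : (m <= n)%N -> {subset u m <= u n}.
  by move=> /subnKC <-; elim: (n - m)%N => [|j IH] v; rewrite ?addn0 // addnS => /IH/uS.
have Du i : exists m, D i (u m).
  exists (pickle i).+1; rewrite /= pickleK.
  by have [] := nxP (i, u (pickle i)) (cu _).
pose F s t := exists m, (s, t) \in u m.
have Fdom s : S s -> exists t, F s t.
  by move=> /sEP[i <-]; have [m [t tm]] := Du (inl (inl i)); exists t, m.
have Fv s t : F s t -> valid s t by case=> m /(proj1 (cu m)).
have [||||g [gi gc gab gF]] := @extend_increasing _ F a b.
- move=> s t s' t' [m sm] [n sn].
  have := proj2 (cu (maxn m n)) _ _ (usub _ _ (leq_maxl m n) _ sm)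
    (usub _ _ (leq_maxr m n) _ sn).
  by [].
- move=> p q /Zd[z [Zz zpq]]; exists z; split=> //.
  by apply: Fdom; apply: ZS.
- move=> p q /Zd[z [Zz /andP[pz zq]]] ap qb.
  have [i iz] := sEP _ (ZS Zz); have [m] := Du (inl (inr i)).
  rewrite /= iz (le_lt_trans ap pz) (lt_le_trans zq qb) => /(_ Zz isT)[s sm].
  by exists s, z; split; [exists m|rewrite pz].
- by move=> s t /Fv[].
have gv s : S s -> valid s (g s).
  by move=> /Fdom[t Fst]; rewrite (gF _ _ Fst); apply: Fv.
exists g; split=> //.
- split=> [x Sx|x Zx|x Sx Yx].
  + have [_ _ H1 H2] := gv _ Sx.
    by have [/H1/AS|/H2/ZS] := pselect (Y x).
  + by have [_ _ _ H] := gv _ (ZS Zx); apply: H => /YZ.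
  + by have [_ _ H _] := gv _ Sx; apply: H.
- move=> i0 ws n p q pq.
  have /andP[mp mq] : p < (p + q) / 2 < q by apply/andP; split; lra.
  have [r1] := rat_in_itvoo mp; have [r2] := rat_in_itvoo mq.
  rewrite !in_itv /= => /andP[r2a r2b] /andP[r1a r1b].
  have [m] := Du (inr (i0, ws, n, (r1, r2))).
  case=> [|x [v [Ax /andP[xa xb] r nA]]]; first by rewrite -(ltr_rat R) (lt_trans r1b).
  exists x; split=> //; first by rewrite (lt_trans r1a) // (lt_trans xb).
  rewrite (gword_run (g := g) _ _ r) // => w wm; apply: gF; exists m.
  by rewrite -surjective_pairing.
Qed.

End Generic.

(** * Meager sets and coloured dense sets *)

Section Meager.
Local Open Scope ring_scope.
Context (R : realType).

Definition meager (B : set R) := exists Bn : nat -> set R,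
  (forall n, nowhere_dense (Bn n)) /\ forall x, B x -> exists n, Bn n x.

Lemma nowhere_dense_meager B : nowhere_dense B -> meager B.
Proof. by move=> Bnd; exists (fun=> B); split=> // x Bx; exists 0%N. Qed.

Lemma nowhere_dense0 : nowhere_dense (@set0 R).
Proof. by apply: nowhere_dense_sub1. Qed.

Lemma meager_bigcup I (K : set I) (B : I -> set R) : countable K ->
  (forall i, K i -> meager (B i)) -> meager (\bigcup_(i in K) B i).
Proof.
move=> /countable_injP[f finj] Bm.
have Bex i : exists Bn : nat -> set R, K i ->
    (forall n, nowhere_dense (Bn n)) /\ forall x, B i x -> exists n, Bn n x.
  have [/Bm[Bn BnP]|nK] := pselect (K i); first by exists Bn.
  by exists (fun=> set0).
have [C CP] := choice Bex.
exists (fun m => if unpickle m is Some (c, n) then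
  [set x | exists i, [/\ K i, f i = c & C i n x]] else set0); split.
  move=> m; case: unpickle => [[c n]|]; last exact: nowhere_dense0.
  have [[i [Ki fi]]|nK] := pselect (exists i, K i /\ f i = c); last first.
    by move=> p q pq; exists p, q; split=> // x _ [i [Ki fi _]]; apply: nK; exists i.
  move=> p q /(proj1 (CP i Ki) n)[p' [q' [? ? ? nC]]].
  exists p', q'; split=> // x /nC nCx [j [Kj fj Cj]]; apply: nCx.
  by have -> : i = j by apply: finj; rewrite ?inE // fi.
move=> x [i Ki Bx]; have [n Cn] := proj2 (CP i Ki) x Bx.
by exists (pickle (f i, n)); rewrite pickleK; exists i.
Qed.

Lemma meagerU (B C : set R) : meager B -> meager C -> meager (B `|` C).
Proof.
move=> Bm Cm; rewrite -bigcup2E.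
apply: (meager_bigcup (K := setT)) => // -[|[|n]] //= _.
exact/nowhere_dense_meager/nowhere_dense0.
Qed.

Lemma meager_avoid (B : set R) : meager B -> exists x, ~ B x.
Proof.
move=> [Bn [Bnd BP]].
have [x [_ xP]] := baire_intervals Bnd (@ltr01 R).
by exists x => /BP[n]; apply: xP.
Qed.

(** Translates of the rationals by the multiples of an irrational number. *)
Lemma colored_dense_sets : exists D : nat -> set R,
  [/\ forall j, order_dense (D j), forall j, countable (D j) &
      forall i j x, D i x -> D j x -> i = j].
Proof.
have [t tirr] : exists t : R, ~ range (@ratr R) t.
  apply: meager_avoid.
  have -> : range (@ratr R) = \bigcup_(q in [set: rat]) [set ratr q].
    by rewrite predeqE => x; split=> [[q _ <-]|[q _ ->]]; exists q.
  apply: meager_bigcup => // q _; apply: nowhere_dense_meager.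
  by apply: nowhere_dense_sub1 => x y -> ->.
exists (fun j => [set x | exists q : rat, x = ratr q + j%:R * t]); split.
- move=> j p q pq; have [|r] := @rat_in_itvoo R (p - j%:R * t) (q - j%:R * t).
    by rewrite ltrD2r.
  rewrite in_itv /= ltrBlDr ltrBrDr => rP.
  by exists (ratr r + j%:R * t); split=> //; exists r.
- move=> j; apply: sub_countable (countableP [set: rat]).
  apply: card_le_trans (card_image_le (fun q : rat => ratr q + j%:R * t) _).
  by apply: subset_card_le => x [q ->]; exists q.
- suff H i j (x : R) : (i < j)%N -> (exists q : rat, x = ratr q + i%:R * t) ->
      (exists q : rat, x = ratr q + j%:R * t) -> False.
    move=> i j x Di Dj; have [ij|ji|//] := ltngtP i j.
      by case: (H _ _ _ ij Di Dj).
    by case: (H _ _ _ ji Dj Di).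
  move=> ij [q ->] [r]; have ji0 : ((j - i)%N)%:R != 0 :> R.
    by rewrite pnatr_eq0 subn_eq0 -ltnNge.
  move=> E; apply: tirr; exists ((q - r) / (j - i)%N%:R) => //.
  rewrite fmorph_div /= rmorphB /= ratr_nat.
  apply: (mulIf ji0); rewrite divfK // natrB 1?ltnW // mulrBr.
  by move: E; rewrite ![_ * t]mulrC; move: (t * i%:R) (t * j%:R) => u v; lra.
Qed.

End Meager.

(** * The recursion *)

Section Construction.
Local Open Scope ring_scope.
Context (R : realType) (d : Order.disp_t) (W : orderType d) (W1 : is_omega1 W).
Context (D : nat -> set R) (Dd : forall j, order_dense (D j))
  (Dcount : forall j, countable (D j))
  (Ddisj : forall i j x, D i x -> D j x -> i = j).
Context (gset : (W -> set R) -> W -> set R) (gcode : W -> set nat)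
  (gset_local : forall T T' a, (forall b, (b < a)%O -> T b = T' b) -> gset T a = gset T' a)
  (guess : forall T, (forall b, countable (T b)) ->
    forall (Y : set R) (M : set nat) (phi : W -> W), exists a,
    [/\ exists b, (b < a)%O, forall b, (b < a)%O -> (phi b < a)%O,
        forall b x, (b < a)%O -> T b x -> (gset T a x <-> Y x) & gcode a = M]).

(** The map added at the stage and the point born there, if any. *)
Definition stage := ((R -> R) * option R)%type.

Implicit Types (F : W -> stage) (a b c : W) (l : seq W) (x y p q : R).

Definition below a l := all (fun c => (c < a)%O) l.
Definition upto a l := all (fun c => (c <= a)%O) l.

Fixpoint ev F l x := if l is c :: l' then ev F l' ((F c).1 x) else x.

Definition born F b :=
  [set y | exists x l, [/\ (F b).2 = Some x, upto b l & y = ev F l x]].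

Definition known F a := [set y | (exists j, D j y) \/ exists b, (b < a)%O /\ born F b y].

(** The part known at stage [a] of the [n]-th set of the tower; the colour [0] is
missing from it, so the colours of the [n]-th set are [1, ..., n.+1]. *)
Definition layer F a n :=
  [set y | (exists j, (j <= n)%N /\ D j.+1 y) \/ exists b, (b < a)%O /\ born F b y].

(** What stage [b] contributes to the countable sets fed to the guessing principle;
the colours are repeated at each stage so that they are covered too. *)
Definition pool F b := [set y | (exists j, D j y) \/ born F b y].

Definition guessed F a := [set y | gset (pool F) a y /\ ~ D 0%N y].

(** A set of integers codes a monotone map by its rational lower and upper
bounds; this is the set of values compatible with the code at [x]. *)
Definition compatible (M : set nat) x := [set y : R | forall q r : rat,
  (M (pickle (q, r, true)) -> ratr q < x -> ratr r <= y) /\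
  (M (pickle (q, r, false)) -> x < ratr q -> y <= ratr r)].

(** The task of mapping the guessed set into the [k]-th set of the tower inside the
interval from [p] to [q]. *)
Definition task (k : nat) (p q : rat) : set nat := [set pickle (k, (p, q))].

(** The words available so far do not see a copy of an interval of the [k]-th set
inside the guessed set. *)
Definition small F a k := forall l, below a l -> forall p q, p < q ->
  exists x, [/\ layer F a k x, p < x < q & ~ guessed F a (ev F l x)].

Definition good_map a F := [/\ increasing (F a).1, order_continuous (F a).1,
  forall x, known F a x -> known F a ((F a).1 x) &
  forall x, D 0%N x -> D 0%N ((F a).1 x)].

Definition no_descent a F := forall l, upto a l -> forall n p q, p < q ->
  exists x, [/\ layer F a n.+1 x, p < x < q & ~ layer F a n (ev F l x)].

Definition task_done a F := forall k (p q : rat), gcode a = task k p q -> p < q ->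
  small F a k -> (forall x, ratr p < (F a).1 x < ratr q) /\
    forall y, known F a y -> guessed F a y -> layer F a k ((F a).1 y).

(** If the guess is the code of a map [h], the birth of [x] leaves no room for
[h x] in the tower: a value compatible with the code at [x] is not known and not
an image of [x], and later stages must keep it out of their own new points, as
this stage does with the values excluded before. *)
Definition killer a F x :=
  (forall l, upto a l -> [/\ ~ known F a (ev F l x), ~ compatible (gcode a) x (ev F l x) &
     forall b x', (b < a)%O -> (F b).2 = Some x' -> ~ compatible (gcode b) x' (ev F l x)]) /\
  forall y, compatible (gcode a) x y -> ~ known F a y.

Definition good_point a F := (forall x, (F a).2 = Some x -> killer a F x) /\
  ((exists x, killer a F x) -> (F a).2 <> None).

Definition good_stage a F :=
  [/\ good_map a F, no_descent a F, task_done a F & good_point a F].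

Lemma upto_below a b l : (a < b)%O -> upto a l -> below b l.
Proof. by move=> ab; apply: sub_all => c ca; apply: le_lt_trans ab. Qed.

(** Finitely many letters have a largest one, so below any stage words either
are empty or live at some earlier stage. *)
Lemma below_max a l : below a l -> l = [::] \/ exists2 b, (b < a)%O & upto b l.
Proof.
elim: l => [|c l IH] /=; first by left.
move=> /andP[ca /IH[->|[b ba ub]]]; right; first by exists c; rewrite //= lexx.
have [bc|cb] := leP b c.
  exists c => //=; rewrite lexx; apply: sub_all ub => e eb; exact: le_trans bc.
by exists b => //=; rewrite ltW.
Qed.

Lemma ev_cat F l1 l2 x : ev F (l1 ++ l2) x = ev F l2 (ev F l1 x).
Proof. by elim: l1 x => //= c l IH x. Qed.

Lemma ev_eq F F' l x : (forall c, c \in l -> (F c).1 = (F' c).1) -> ev F l x = ev F' l x.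
Proof.
elim: l x => //= c l IH x FF'; rewrite FF' ?mem_head // IH // => b bl.
by apply: FF'; rewrite inE bl orbT.
Qed.

Lemma layer_sub F a n : layer F a n `<=` known F a.
Proof. by move=> y [[j [_ Dy]]|]; [left; exists j.+1|right]. Qed.

Lemma layer_mono F a m n : (m <= n)%N -> layer F a m `<=` layer F a n.
Proof. by move=> mn y [[j [jm Dy]]|]; [left; exists j; rewrite (leq_trans jm)|right]. Qed.

Lemma known_mono F a b : (a <= b)%O -> known F a `<=` known F b.
Proof. by move=> ab y [|[c [ca Ty]]]; [left|right; exists c; rewrite (lt_le_trans ca)]. Qed.

Lemma layer_stage F a b n : (a <= b)%O -> layer F a n `<=` layer F b n.
Proof. by move=> ab y [|[c [ca Ty]]]; [left|right; exists c; rewrite (lt_le_trans ca)]. Qed.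

Lemma layer_dense F a n : order_dense (layer F a n).
Proof.
by move=> p q /(Dd 1%N)[x [Dx xpq]]; exists x; split=> //; left; exists 0%N.
Qed.

Section Congruence.
Context (a : W) (F F' : W -> stage)
  (FF' : forall b, (b < a)%O -> F b = F' b) (FF1 : (F a).1 = (F' a).1).

Lemma ev_upto_eq l x : upto a l -> ev F l x = ev F' l x.
Proof.
move=> /allP la; apply: ev_eq => c /la; rewrite le_eqVlt => /orP[/eqP ->//|ca].
by rewrite FF'.
Qed.

Lemma ev_below_eq l x : below a l -> ev F l x = ev F' l x.
Proof. by move=> /allP la; apply: ev_eq => c /la ca; rewrite FF'. Qed.

Lemma born_eq b : (b < a)%O -> born F b = born F' b.
Proof.
move=> ba; rewrite predeqE => y; split=> -[x [l [Fb bl ->]]]; exists x, l; split=> //.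
- by rewrite -FF'.
- exact/ev_below_eq/(upto_below ba).
- by rewrite FF'.
- exact/esym/ev_below_eq/(upto_below ba).
Qed.

Lemma known_eq : known F a = known F' a.
Proof.
rewrite predeqE => y; split=> -[|[b [ba Ty]]]; try by left.
  by right; exists b; rewrite -born_eq.
by right; exists b; rewrite born_eq.
Qed.

Lemma layer_eq n : layer F a n = layer F' a n.
Proof.
rewrite predeqE => y; split=> -[|[b [ba Ty]]]; try by left.
  by right; exists b; rewrite -born_eq.
by right; exists b; rewrite born_eq.
Qed.

Lemma guessed_eq : guessed F a = guessed F' a.
Proof.
rewrite /guessed (_ : gset (pool F) a = gset (pool F') a) //; apply: gset_local => b ba.
by rewrite /pool born_eq.
Qed.

Lemma killer_eq x : killer a F x -> killer a F' x.
Proof.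
move=> [H1 H2]; split; last by rewrite -known_eq.
move=> l la; have [nS nG nO] := H1 l la; rewrite -known_eq -(ev_upto_eq _ la); split=> //.
by move=> b x' ba; rewrite -FF' //; apply: nO.
Qed.

Lemma good_map_eq : good_map a F -> good_map a F'.
Proof. by rewrite /good_map known_eq FF1. Qed.

Lemma no_descent_eq : no_descent a F -> no_descent a F'.
Proof.
move=> H l la n p q pq; have [x [Ax xpq nA]] := H l la n p q pq.
by exists x; rewrite -!layer_eq -(ev_upto_eq _ la).
Qed.

Lemma task_done_eq : task_done a F -> task_done a F'.
Proof.
move=> H k p q Lak pq sm; rewrite -FF1 -known_eq -guessed_eq -layer_eq.
apply: H => // l la r s rs.
have [x [Ax xrs nY]] := sm l la r s rs; exists x.
by rewrite layer_eq guessed_eq (ev_below_eq _ la).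
Qed.

End Congruence.

(** The relation to be solved at a stage only depends on the history up to this
stage, as recursion requires. *)
Lemma good_stage_eq a F F' : (forall b, (b <= a)%O -> F b = F' b) ->
  good_stage a F -> good_stage a F'.
Proof.
move=> FF' [g1 g2 g3 [k1 k2]].
have FF b : (b < a)%O -> F b = F' b by move=> /ltW/FF'.
have FF1 : (F a).1 = (F' a).1 by rewrite FF'.
split; [exact: good_map_eq g1|exact: no_descent_eq g2|exact: task_done_eq g3|].
split=> [x|[x kx]]; rewrite -FF' //; first by move=> /k1; apply: killer_eq.
by apply: k2; exists x; apply: killer_eq kx => // b /FF.
Qed.

Lemma born_fresh b F y : good_stage b F -> born F b y -> ~ known F b y.
Proof.
move=> [_ _ _ [+ _]] [x [l [Fb bl ->]]] => /(_ x Fb)[+ _].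
by move=> /(_ l bl)[].
Qed.

Section Invariants.
Context (a : W) (F : W -> stage) (past : forall b, (b < a)%O -> good_stage b F).

(** A known point that is too young for the map was born after the map was added,
hence together with its image. *)
Lemma map_known c x : (c < a)%O -> known F a x -> known F a ((F c).1 x).
Proof.
move=> ca Sx; have [[_ _ gS _] _ _ _] := past ca.
have [Scx|nScx] := pselect (known F c x); first exact: known_mono (ltW ca) _ (gS _ Scx).
case: Sx => [Dx|[b [ba Tx]]]; first by case: nScx; left.
have cb : (c <= b)%O by rewrite leNgt; apply/negP => bc; apply: nScx; right; exists b.
case: Tx => z [l [Fb bl ->]]; right; exists b; split=> //.
exists z, (rcons l c); rewrite -cats1 ev_cat /=; split=> //.
by rewrite /upto all_cat /= cb andbT; apply/andP.
Qed.

Lemma ev_increasing l : below a l -> increasing (ev F l).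
Proof.
elim: l => [|c l IH] /=; first by move=> _ x y.
by move=> /andP[/past[[gi _ _ _] _ _ _] /IH li] x y /gi/li.
Qed.

Lemma ev_known l x : below a l -> known F a x -> known F a (ev F l x).
Proof.
by elim: l x => //= c l IH x /andP[ca la] Sx; apply: IH => //; apply: map_known.
Qed.

Lemma ev_D0 l x : below a l -> D 0%N x -> D 0%N (ev F l x).
Proof.
elim: l x => //= c l IH x /andP[/past[[_ _ _ gZ] _ _ _] la] Sx.
by apply: IH => //; apply: gZ.
Qed.

(** A point known at stage [b] has settled its membership in the tower, since points
born later are not known at stage [b]. *)
Lemma new_color b n y : (b < a)%O -> known F b y -> layer F a n y -> layer F b n y.
Proof.
move=> ba Sy [Dy|[c [ca Ty]]]; first by left.
have [bc|cb] := leP b c; last by right; exists c.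
by case: (born_fresh (past ca) Ty); apply: known_mono Sy.
Qed.

End Invariants.

Lemma ev_upto_known a F l x : (forall b, (b <= a)%O -> good_stage b F) -> upto a l ->
  known F a x -> known F a (ev F l x).
Proof.
move=> good; elim: l x => //= c l IH x /andP[ca la] Sx; apply: IH => //.
move: ca; rewrite le_eqVlt => /orP[/eqP ->|ca].
  by have [[_ _ gS _] _ _ _] := good _ (lexx a); apply: gS.
by apply: (@map_known a) => // b /ltW/good.
Qed.

(** A nonempty word belongs to the stage of its largest letter, where it does not
descend; the empty word does not send the colour [n.+2] to smaller colours. *)
Lemma no_descent_below a F l n p q : (forall b, (b < a)%O -> good_stage b F) ->
  below a l -> p < q ->
  exists x, [/\ layer F a n.+1 x, p < x < q & ~ layer F a n (ev F l x)].
Proof.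
move=> past la pq; have [->|[b ba bl]] := below_max la.
  have [x [Dx xpq]] := Dd n.+2 pq.
  exists x; split=> //; first by left; exists n.+1.
  move=> /= [[j [jn Dj]]|[b [ba Tx]]].
    by move: jn; case: (Ddisj Dj Dx) => ->; rewrite ltnn.
  by apply: (born_fresh (past _ ba) Tx); left; exists n.+2.
have [_ nd _ _] := past _ ba; have [x [Ax xpq nA]] := nd l bl n p q pq.
exists x; split=> //; first exact: layer_stage (ltW ba) _ Ax.
move=> H; apply/nA/(new_color past ba) => //.
apply: ev_upto_known => //; last exact: layer_sub Ax.
by move=> c cb; apply: past; apply: le_lt_trans ba.
Qed.

Lemma upto_countable a : countable [set l | upto a l].
Proof.
apply: sub_countable (countable_words (omega1_upto W1 a)).
by apply: subset_card_le => l /= /allP.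
Qed.

Lemma below_countable a : countable [set l | below a l].
Proof.
apply: sub_countable (countable_words (omega1_below W1 a)).
by apply: subset_card_le => l /= /allP.
Qed.

Lemma born_countable F b : countable (born F b).
Proof.
apply: (@sub_countable _ _ _ (\bigcup_(l in [set l | upto b l])
    [set ev F l (odflt 0 (F b).2)])).
  by apply: subset_card_le => y [x [l [Fb bl ->]]]; exists l => //; rewrite Fb.
by apply: bigcup_countable => [|l _]; [exact: upto_countable|exact: countable1].
Qed.

Lemma D_countable : countable [set y | exists j, D j y].
Proof.
apply: (@sub_countable _ _ _ (\bigcup_(j in [set: nat]) D j)).
  by apply: subset_card_le => y [j Dy]; exists j.
by apply: bigcup_countable.
Qed.

Lemma countableU (X : Type) (P Q : set X) : countable P -> countable Q ->
  countable (P `|` Q).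
Proof.
by move=> Pc Qc; rewrite -bigcup2E; apply: bigcup_countable => // -[|[|n]] //= _.
Qed.

Lemma pool_countable F b : countable (pool F b).
Proof. exact: countableU D_countable (born_countable F b). Qed.

Lemma known_countable F a : countable (known F a).
Proof.
apply: (@sub_countable _ _ _ ([set y | exists j, D j y] `|`
    \bigcup_(b in [set b | (b < a)%O]) born F b)).
  apply: subset_card_le => y [|[b [ba Ty]]]; [by left|by right; exists b].
apply: countableU D_countable _; apply: bigcup_countable; first exact: omega1_below.
by move=> b _; apply: born_countable.
Qed.

Definition update F a (v : stage) b := if b == a then v else F b.

Lemma update_lt F a v b : (b < a)%O -> F b = update F a v b.
Proof. by move=> ba; rewrite /update (lt_eqF ba). Qed.

Lemma update_eq F a v : update F a v a = v.
Proof. by rewrite /update eqxx. Qed.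

(** Earlier letters between two occurrences of [a] merge into a single word of
the enumeration. *)
Lemma upto_gword F a g o (lam : nat -> seq W) l :
  (forall n, below a (lam n)) -> (forall l, below a l -> exists n, lam n = l) ->
  upto a l -> exists i0 ws, forall x,
    ev (update F a (g, o)) l x = gword (fun n => ev F (lam n)) g i0 ws x.
Proof.
move=> lamB lamP; elim: l => [|c l IH] /=.
  by have [i li] := lamP [::] isT; exists i, [::] => x /=; rewrite li.
move=> /andP[ca /IH[i0 [ws E]]]; move: ca; rewrite le_eqVlt => /orP[/eqP ->|ca].
  have [i li] := lamP [::] isT.
  by exists i0, (i :: ws) => x /=; rewrite li E update_eq.
case: ws E => [|w ws] E.
  have [|i li] := lamP (c :: lam i0); first by rewrite /below /= ca; apply: lamB.
  by exists i, [::] => x; rewrite E /= li /= -update_lt.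
have [|i li] := lamP (c :: lam w); first by rewrite /below /= ca; apply: lamB.
by exists i0, (i :: ws) => x; rewrite E /= li /= -update_lt.
Qed.

(** If the new map is the identity, its letter can be erased. *)
Lemma upto_id F a o l : upto a l ->
  exists2 l', below a l' & forall x, ev (update F a (id, o)) l x = ev F l' x.
Proof.
elim: l => [|c l IH] /=; first by exists [::].
move=> /andP[ca /IH[l' l'a E]]; move: ca; rewrite le_eqVlt => /orP[/eqP ->|ca].
  by exists l' => // x; rewrite /= update_eq E.
by exists (c :: l') => [|x]; rewrite /below /= ?ca // E -update_lt.
Qed.

(** If the guess does not set a task that can be fulfilled, the identity does no
harm. *)
Lemma map_stage a F : (forall b, (b < a)%O -> good_stage b F) ->
  exists g, forall o, [/\ good_map a (update F a (g, o)),
    no_descent a (update F a (g, o)) &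
    task_done a (update F a (g, o))].
Proof.
move=> past.
have congr g o : [/\ known (update F a (g, o)) a = known F a,
    forall n, layer (update F a (g, o)) a n = layer F a n,
    guessed (update F a (g, o)) a = guessed F a &
    forall l x, below a l -> ev (update F a (g, o)) l x = ev F l x].
  have E b : (b < a)%O -> update F a (g, o) b = F b by move=> ba; rewrite -update_lt.
  split; [exact: known_eq|exact: layer_eq|exact: guessed_eq|].
  by move=> l x; apply: ev_below_eq.
have [[k [p [q [Lak pq sm]]]]|nosm] := pselect (exists k (p q : rat),
    [/\ gcode a = task k p q, p < q & small F a k]); last first.
  exists id => o; have [ES EA EY Eev] := congr id o; rewrite /good_map ES update_eq; split.
  - split=> // x c; split=> /= cx.
      by have [y [_ /andP[? ?]]] := Dd 0%N cx; exists y.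
    by have [y [_ /andP[? ?]]] := Dd 0%N cx; exists y.
  - move=> l /(upto_id F o)[l' l'a E] n r s rs; rewrite !EA.
    by have [x xP] := no_descent_below n past l'a rs; exists x; rewrite E.
  - move=> k p q Lak pq sm; case: nosm; exists k, p, q; split=> // l la r s rs.
    by have [x] := sm l la r s rs; rewrite EA EY Eev //; exists x.
have [lam [lamB lamP]] := countable_enum (below_countable a) (isT : below a [::]).
have AZ n x : layer F a n x -> ~ D 0%N x.
  move=> [[j [_ Dj]] D0|[b [ba Tx]] D0]; first by have := Ddisj Dj D0.
  by apply: (born_fresh (past _ ba) Tx); left; exists 0%N.
have [g [gi gc gab [gS gZ gY] gnd]] := @generic_map R (known F a) (D 0%N) (layer F a)
    (fun n => ev F (lam n)) (guessed F a) k (ratr p) (ratr q)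
    (etrans (ltr_rat R p q) pq) (known_countable F a)
    (fun x Dx => or_introl (ex_intro _ 0%N Dx))
    (@layer_sub F a) AZ (@layer_mono F a) (@layer_dense F a) (Dd 0%N)
    (fun i => ev_increasing past (lamB i)) (fun i x => ev_known past (lamB i))
    (fun i x => ev_D0 past (lamB i)) (fun i n p' q' => no_descent_below n past (lamB i))
    (fun i => sm _ (lamB i)) (fun x => @proj2 _ _).
exists g => o; have [ES EA EY Eev] := congr g o.
rewrite /good_map /task_done ES update_eq; split=> //.
  move=> l la n r s rs; rewrite !EA; have [i0 [ws E]] := upto_gword F g o lamB lamP la.
  by have [x xP] := gnd i0 ws n r s rs; exists x; rewrite E.
move=> k' p' q' Lak' p'q' _.
have /(pcan_inj pickleK)[-> -> ->] : pickle (k', (p', q')) = pickle (k, (p, q)).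
  have : gcode a (pickle (k, (p, q))) by rewrite Lak.
  by rewrite Lak' => ->.
by rewrite EY EA; split=> // y Sy; apply: gY.
Qed.

(** The map is found first, then the point, since the words that decide which
points may be born contain the new letter. *)
Lemma stages_exist : exists F, forall a, good_stage a F.
Proof.
apply: (stage_recursion W1 (id, None)); first exact: good_stage_eq.
move=> a F past; have [g gP] := map_stage past.
pose G := update F a (g, None).
have keq o x : killer a G x <-> killer a (update F a (g, o)) x.
  by split; apply: killer_eq => [b ba|]; rewrite /G ?update_eq // -!update_lt.
have [[x kx]|nk] := pselect (exists x, killer a G x).
  exists (g, Some x); rewrite -/(update F a (g, Some x)).
  have [gm gn gt] := gP (Some x); split=> //; split; rewrite update_eq //= => y [<-].
  exact/keq.
exists (g, None); rewrite -/(update F a (g, None)).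
have [gm gn gt] := gP None; split=> //; split; rewrite update_eq //=.
Qed.

Section Final.
Context (F : W -> stage) (good : forall a, good_stage a F).

Definition tower n :=
  [set y | (exists j, (j <= n)%N /\ D j.+1 y) \/ exists b, born F b y].

Lemma layer_tower a n : layer F a n `<=` tower n.
Proof. by move=> y [|[b [_ Ty]]]; [left|right; exists b]. Qed.

Lemma tower_layer a n y : known F a y -> tower n y -> layer F a n y.
Proof.
move=> Sy [Dy|[b Ty]]; first by left.
have [ab|ba] := leP a b; last by right; exists b.
by case: (born_fresh (good b) Ty); apply: known_mono Sy.
Qed.

Lemma tower_mono m n : (m <= n)%N -> tower m `<=` tower n.
Proof. by move=> mn y [[j [jm Dy]]|]; [left; exists j; rewrite (leq_trans jm)|right]. Qed.

Lemma word_bound l : exists a, below a l.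
Proof.
have [|a aP] := @countable_bounded _ _ W1 [set c | c \in l].
  exact: finite_set_countable (finite_seq l).
by exists a; apply/allP.
Qed.

Lemma word_increasing l : increasing (ev F l).
Proof. by have [a la] := word_bound l; apply: (@ev_increasing a). Qed.

Lemma word_continuous l : order_continuous (ev F l).
Proof.
elim: l => [|c l IH] /=.
  move=> x c; split=> /= cx.
    by have [y [_ /andP[? ?]]] := Dd 0%N cx; exists y.
  by have [y [_ /andP[? ?]]] := Dd 0%N cx; exists y.
apply: (order_continuous_comp (f := ev F l)) => //; first exact: word_increasing.
by have [[]] := good c.
Qed.

Lemma no_descent_final l n p q : p < q ->
  exists x, [/\ tower n.+1 x, p < x < q & ~ tower n (ev F l x)].
Proof.
move=> pq; have [a la] := word_bound l.
have [|x [Ax xpq nA]] := @no_descent_below a F l n p q _ la pq; first by [].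
exists x; split=> //; first exact: layer_tower Ax.
by move=> H; apply/nA/tower_layer => //; apply: (@ev_known a) => //; apply: layer_sub Ax.
Qed.

Lemma shrink_rat p q : p < q -> exists r s : rat, [/\ p < ratr r, r < s & ratr s < q].
Proof.
move=> pq; have /andP[mp mq] : p < (p + q) / 2 < q by apply/andP; split; lra.
have [r] := rat_in_itvoo mp; have [s] := rat_in_itvoo mq.
rewrite !in_itv /= => /andP[s1 s2] /andP[r1 r2]; exists r, s; split=> //.
by rewrite -(ltr_rat R) (lt_trans r2).
Qed.

(** The dichotomy.  If no word maps the part of [tower k] in an interval into [Y],
this is reflected by all stages of a club, and at a stage of the club where
[Y] is guessed correctly the task of mapping [Y] into [tower k] was carried out;
points born later are mapped among themselves. *)
Lemma word_or_map k (Y : set R) : Y `<=` \bigcup_n tower n ->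
  (exists l p q, p < q /\ forall x, tower k x -> p < x < q -> Y (ev F l x)) \/
  forall p q, p < q -> exists2 g, increasing g &
    forall y, Y y -> tower k (g y) /\ p < g y < q.
Proof.
move=> YA; have [|nl] := pselect (exists l p q, p < q /\
  forall x, tower k x -> p < x < q -> Y (ev F l x)); [by left|right=> p q].
move=> /shrink_rat[p0 [q0 [pp0 p0q0 q0q]]].
(* Each word and rational interval has a witness against the first alternative,
   which is known from some stage on. *)
have wit (lpq : seq W * (rat * rat)) : exists c, lpq.2.1 < lpq.2.2 ->
    exists x, [/\ layer F c k x, ratr lpq.2.1 < x < ratr lpq.2.2 & ~ Y (ev F lpq.1 x)].
  case: lpq => l [r s] /=; have [a _] := word_bound l.
  have [rs|nrs] := boolP (r < s); last by exists a.
  have [x [Ax xrs nY]] : exists x, [/\ tower k x, ratr r < x < ratr s & ~ Y (ev F l x)].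
    apply: contrapT => nx; apply: nl; exists l, (ratr r), (ratr s).
    rewrite ltr_rat; split=> // x Ax xrs; apply: contrapT => nY.
    by apply: nx; exists x.
  case: Ax => [Dx|[b Tx]]; first by exists a => _; exists x; split=> //; left.
  have [c bc] := countable_bounded W1 (countable1 b).
  by exists c => _; exists x; split=> //; right; exists b; rewrite bc.
have [st stP] := choice wit.
have phiE b : exists c, forall l r s, upto b l -> (st (l, (r, s)) < c)%O.
  have [|c cP] := @countable_bounded _ _ W1 (\bigcup_(l in [set l | upto b l])
      range (fun rs => st (l, rs))).
    apply: bigcup_countable; first exact: upto_countable.
    by move=> l _; apply: sub_countable (card_image_le _ _) (countableP _).
  by exists c => l r s lb; apply: cP; exists l => //; exists (r, s).
(* A stage closed under [phi] reflects the failure of the first alternative. *)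
have [phi phiP] := choice phiE.
have [a [aN0 acl aY Lak]] := guess (pool_countable F) Y (task k p0 q0) phi.
have YS y : known F a y -> (guessed F a y <-> Y y).
  move=> Sy; have TY : gset (pool F) a y <-> Y y.
    case: Sy => [Dy|[b [ba Ty]]]; last by apply: (aY b) => //; right.
    by case: aN0 => b ba; apply: (aY b) => //; left.
  rewrite /guessed -TY; split=> [[]//|Ty]; split=> // D0.
  have [n _ [[j [_ Dj]]|[b Tb]]] := YA y (proj1 TY Ty).
    by have := Ddisj Dj D0.
  by apply: (born_fresh (good b) Tb); left; exists 0%N.
have sm : small F a k.
  move=> l la r s /shrink_rat[r0 [s0 [rr0 r0s0 s0s]]].
  have [b ba lb] : exists2 b, (b < a)%O & upto b l.
    by have [->|//] := below_max la; case: aN0 => b ba; exists b.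
  have [x [Ax /andP[x1 x2] nY]] := stP (l, (r0, s0)) r0s0.
  have stA : (st (l, (r0, s0)) < a)%O by apply: lt_trans (acl _ ba); apply: phiP.
  have Aax : layer F a k x by apply: layer_stage Ax; apply: ltW.
  exists x; split=> //; first by rewrite (lt_trans rr0 x1) (lt_trans x2 s0s).
  by move=> /YS Ye; apply: nY; apply: Ye; apply: ev_known => //; apply: layer_sub Aax.
have [[gi _ _ _] _ gt _] := good a.
have [gpq gA] := gt _ _ _ Lak p0q0 sm.
exists (F a).1 => // y Yy; split; last first.
  by have /andP[g1 g2] := gpq y; rewrite (lt_trans pp0) // (lt_trans g2).
have [Sy|nSy] := pselect (known F a y).
  by apply: layer_tower; apply: gA => //; apply/YS.
have [n _ [[j [_ Dj]]|[b [x [l [Fb bl yE]]]]]] := YA y Yy.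
  by case: nSy; left; exists j.+1.
have ab : (a <= b)%O.
  rewrite leNgt; apply/negP => ba; apply: nSy; right; exists b; split=> //.
  by exists x, l.
right; exists b, x, (rcons l a); rewrite -cats1 ev_cat /= yE; split=> //.
by rewrite /upto all_cat /= ab andbT; apply/andP.
Qed.

Section NoEmbedding.
Context (n : nat) (h : R -> R)
  (h_inc : forall x y, tower n.+1 x -> tower n.+1 y -> x < y -> h x < h y)
  (h_tower : forall x, tower n.+1 x -> tower n (h x)).

(** The code only says on which side of rational points the graph of [h] passes, so
it is a set of integers; it determines [h] where [h] has no jump. *)
Definition code : set nat := [set m | exists (q r : rat) (b : bool),
  m = pickle (q, r, b) /\ exists z, tower n.+1 z /\
    if b then z < ratr q /\ ratr r < h z else ratr q < z /\ h z < ratr r].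

Lemma code_true (q r : rat) : code (pickle (q, r, true)) ->
  exists z, [/\ tower n.+1 z, z < ratr q & ratr r < h z].
Proof.
by move=> [q' [r' [b [/(pcan_inj pickleK)[-> -> <-] [z [Az [? ?]]]]]]]; exists z.
Qed.

Lemma code_false (q r : rat) : code (pickle (q, r, false)) ->
  exists z, [/\ tower n.+1 z, ratr q < z & h z < ratr r].
Proof.
by move=> [q' [r' [b [/(pcan_inj pickleK)[-> -> <-] [z [Az [? ?]]]]]]]; exists z.
Qed.

Lemma compatible_h x : tower n.+1 x -> compatible code x (h x).
Proof.
move=> Ax q r; split.
  move=> /code_true[z [Az zq rh]] qx.
  by apply: ltW; apply: lt_trans rh _; apply: h_inc => //; apply: lt_trans qx.
move=> /code_false[z [Az zq rh]] qx.
by apply: ltW; apply: lt_trans rh; apply: h_inc => //; apply: lt_trans zq.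
Qed.

Lemma compatible_ge x y z : compatible code x y -> tower n.+1 z -> z < x -> h z <= y.
Proof.
move=> xy Az zx; rewrite leNgt; apply/negP => yz.
have [r] := rat_in_itvoo yz; have [q] := rat_in_itvoo zx.
rewrite !in_itv /= => /andP[zq qx] /andP[yr rz].
have [H _] := xy q r; have : ratr r <= y.
  by apply: H => //; exists q, r, true; split=> //; exists z.
by rewrite leNgt yr.
Qed.

Lemma compatible_le x y z : compatible code x y -> tower n.+1 z -> x < z -> y <= h z.
Proof.
move=> xy Az zx; rewrite leNgt; apply/negP => yz.
have [r] := rat_in_itvoo yz; have [q] := rat_in_itvoo zx.
rewrite !in_itv /= => /andP[zq qx] /andP[yr rz].
have [_ H] := xy q r; have : y <= ratr r.
  by apply: H => //; exists q, r, false; split=> //; exists z.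
by rewrite leNgt rz.
Qed.

Lemma tower_dense : order_dense (tower n.+1).
Proof. by move=> p q /(Dd 1%N)[x [Dx xpq]]; exists x; split=> //; left; exists 0%N. Qed.

Lemma compatible_point_nowhere_dense s : nowhere_dense [set x | compatible code x s].
Proof.
move=> p q /tower_dense[u [Au /andP[pu uq]]].
have [v [Av /andP[uv vq]]] := tower_dense uq; have huv := h_inc Au Av uv.
have [sv|vs] := ltP s (h v).
  exists v, q; split=> //; first by rewrite ltW // (lt_trans pu).
  move=> x /andP[vx _] /compatible_ge/(_ Av vx).
  by rewrite leNgt sv.
exists p, u; split=> //; first exact: ltW.
move=> x /andP[_ xu] /compatible_le/(_ Au xu).
by rewrite leNgt (lt_le_trans huv).
Qed.

(** By [no_descent] the map [h] differs from a given word at some point of any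
interval, say [h z < ev F l z].  By continuity of the word, [h z] is less than
its values slightly to the left of [z], where the values compatible with the
code are at most [h z]. *)
Lemma compatible_word_nowhere_dense a l : upto a l ->
  nowhere_dense [set x | compatible code x (ev F l x)].
Proof.
move=> la p q pq; have [_ nd _ _] := good a.
have [z [Az /andP[pz zq] nA]] := nd l la n p q pq.
have Afz : tower n.+1 z := layer_tower Az.
have hz : h z <> ev F l z.
  move=> hz; apply: nA; apply: tower_layer; last by rewrite -hz; apply: h_tower.
  by apply: ev_upto_known => //; apply: layer_sub Az.
have li := word_increasing l; have lc := word_continuous l.
have [hlt|hgt|//] := ltgtP (h z) (ev F l z).
  have [y [yz hy]] := proj1 (lc _ _) hlt.
  exists (Num.max p y), z; split; rewrite ?le_max ?lexx // ?gt_max ?pz ?yz ?(ltW zq) //.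
  move=> x /andP[]; rewrite gt_max => /andP[_ /li yx] xz /compatible_le/(_ Afz xz).
  by rewrite leNgt (lt_trans hy yx).
have [y [yz hy]] := proj2 (lc _ _) hgt.
exists z, (Num.min q y); split; rewrite ?ge_min ?lexx // ?lt_min ?zq ?yz ?(ltW pz) //.
move=> x /andP[zx]; rewrite lt_min => /andP[_ /li yx] /compatible_ge/(_ Afz zx).
by rewrite leNgt (lt_trans yx hy).
Qed.

(** The compatible values form an interval; if it had two points, it would contain
a point of a dense set of known points. *)
Lemma compatible_unique a x y z : killer a F x ->
  compatible (gcode a) x y -> compatible (gcode a) x z -> y = z.
Proof.
move=> [_ kS].
suff H y' z' : y' < z' -> compatible (gcode a) x y' -> compatible (gcode a) x z' -> False.
  by move=> cy cz; have [/H|/H|//] := ltgtP y z; case.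
move=> /(Dd 0%N)[s [Ds /andP[ys sz]]] cy cz; apply: (kS s); last by left; exists 0%N.
move=> q r; have [y1 _] := cy q r; have [_ z2] := cz q r; split=> [C xq|C xq].
  by rewrite (le_trans (y1 C xq)) // ltW.
by rewrite (le_trans _ (z2 C xq)) // ltW.
Qed.

Lemma killer_exists a : gcode a = code -> exists x, killer a F x.
Proof.
move=> Lac; pose old b x := exists2 x', (F b).2 = Some x' & compatible (gcode b) x' x.
(* The four meager sets: an image of [x] is known; an image of [x] is compatible
   at [x]; an image of [x] is excluded by an earlier stage; a known point is
   compatible at [x]. *)
have [|x xP] := @meager_avoid R ((\bigcup_(l in [set l | upto a l])
    ((\bigcup_(s in known F a) [set x | ev F l x = s]) `|`
     ([set x | compatible code x (ev F l x)] `|`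
      \bigcup_(b in [set b | (b < a)%O]) [set x | old b (ev F l x)]))) `|`
    \bigcup_(s in known F a) [set x | compatible code x s]).
  apply: meagerU; last first.
    apply: meager_bigcup => [|s _]; first exact: known_countable.
    exact/nowhere_dense_meager/compatible_point_nowhere_dense.
  apply: meager_bigcup => [|l la]; first exact: upto_countable.
  have linj := increasing_inj (word_increasing l).
  apply: meagerU; last apply: meagerU.
  - apply: meager_bigcup => [|s _]; first exact: known_countable.
    by apply/nowhere_dense_meager/nowhere_dense_sub1 => x y <- /linj.
  - exact/nowhere_dense_meager/compatible_word_nowhere_dense/la.
  - apply: meager_bigcup => [|b _]; first exact: omega1_below.
    apply/nowhere_dense_meager/nowhere_dense_sub1 => x y [x1 Fx cx] [y1 Fy cy].
    apply: linj; have [_ _ _ [k1 _]] := good b.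
    move: Fy cy; rewrite Fx => -[<-] cy.
    exact: compatible_unique (k1 _ Fx) cx cy.
exists x; split=> [l la|s cs Ss]; last by apply: xP; right; exists s; rewrite // -Lac.
split=> [Se|cx|b x' ba Fb cb]; apply: xP; left; exists l => //.
- by left; exists (ev F l x).
- by right; left; rewrite -Lac.
- by right; right; exists b => //; exists x'.
Qed.

(** At a stage guessing the code of [h] a point [x] is born.  Its value [h x] is
compatible at [x] and belongs to the tower, but it is not known at this stage,
not born with [x], and not born later, because it is excluded. *)
Lemma no_embedding : False.
Proof.
have [a [_ _ _ Lac]] := guess (pool_countable F) set0 code id.
have kex := killer_exists Lac; have [_ _ _ [k1 k2]] := good a.
case Fa : (F a).2 (k2 kex) => [x|] // _.
have [kl kS] := k1 _ Fa.
have Ax : tower n.+1 x by right; exists a, x, [::].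
have cx : compatible (gcode a) x (h x) by rewrite Lac; apply: compatible_h.
have nS := kS _ cx.
have [[j [_ Dj]]|[b Tb]] := h_tower Ax; first by apply: nS; left; exists j.+1.
have [ba|ab|ab] := ltgtP b a; first by apply: nS; right; exists b.
  have [z [l [Fb bl hx]]] := Tb; have [_ _ _ [kb _]] := good b.
  have [/(_ l bl)[_ _ H] _] := kb _ Fb.
  by apply: (H a x ab Fa); rewrite -hx.
subst b; have [z [l [Fz al hx]]] := Tb; move: Fz; rewrite Fa => -[xz].
have [_ nc _] := kl l al; apply: nc; rewrite xz -hx.
by rewrite -xz.
Qed.

End NoEmbedding.

End Final.
End Construction.

(** * The tower of real types *)

Section Tower.
Local Open Scope ring_scope.

Lemma tower_exists (R : realType) : diamond_omega1 -> exists A : nat -> set R,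
  [/\ forall m n, (m <= n)%N -> A m `<=` A n, exists x, A 0%N x,
      forall n (h : R -> R), (forall x y, A n.+1 x -> A n.+1 y -> x < y -> h x < h y) ->
        ~ (forall x, A n.+1 x -> A n (h x)),
      forall n p q, p < q -> exists2 g, increasing g &
        forall x, A n x -> A n.+1 (g x) /\ p < g x < q &
      forall k (Y : set R), Y `<=` \bigcup_n A n ->
        (exists (w : R -> R) p q, [/\ increasing w, p < q &
          forall x, A k x -> p < x < q -> Y (w x)]) \/
        forall p q, p < q -> exists2 g, increasing g &
          forall y, Y y -> A k (g y) /\ p < g y < q].
Proof.
move=> [d [W [W1 diam]]].
have [D [Dd Dcount Ddisj]] := colored_dense_sets R.
have [gset [gcode [gset_local guess]]] := diamond_guess W1 R diam.
have [F good] := stages_exist W1 Dd Dcount Ddisj gcode gset_local.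
exists (tower D F); split.
- exact: tower_mono.
- have [x [Dx _]] := Dd 1%N 0 1 ltr01.
  by exists x; left; exists 0%N.
- by move=> n h hinc hA; apply: (no_embedding W1 Dd Dcount guess good hinc hA).
- move=> n p q pq.
  have YA : tower D F n `<=` \bigcup_m tower D F m by move=> x Ax; exists n.
  have [[l [r [s [rs H]]]]|] := word_or_map W1 Dcount Ddisj guess good n.+1 YA;
    last exact.
  have [x [Ax xrs nA]] := no_descent_final W1 Dd Ddisj good l n rs.
  by case: nA; apply: H.
- move=> k Y YA.
  have [[l [r [s [rs H]]]]|] := word_or_map W1 Dcount Ddisj guess good k YA;
    last by right.
  by left; exists (ev F l), r, s; split=> //; apply: (word_increasing W1 good).
Qed.

End Tower.

(** * From the tower to a Hagendorf order *)

Section Hagendorf.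
Local Open Scope ring_scope.
Context (R : realType) (A : nat -> set R)
  (Amono : forall m n, (m <= n)%N -> A m `<=` A n) (A0 : exists x, A 0%N x)
  (A_noemb : forall n (h : R -> R),
     (forall x y, A n.+1 x -> A n.+1 y -> x < y -> h x < h y) ->
     ~ (forall x, A n.+1 x -> A n (h x)))
  (A_up : forall n p q, p < q -> exists2 g, increasing g &
     forall x, A n x -> A n.+1 (g x) /\ p < g x < q)
  (A_dich : forall k (Y : set R), Y `<=` \bigcup_n A n ->
     (exists (w : R -> R) p q, [/\ increasing w, p < q &
        forall x, A k x -> p < x < q -> Y (w x)]) \/
     forall p q, p < q -> exists2 g, increasing g &
        forall y, Y y -> A k (g y) /\ p < g y < q).

Definition staircase := [set x : R | exists n, n%:R < x /\ A n x].

Lemma A_point n p q : p < q -> exists x, A n.+1 x /\ p < x < q.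
Proof.
move=> /(A_up n)[g _ gP]; case: A0 => x /(Amono (leq0n n))/gP H; by exists (g x).
Qed.

Lemma staircase_below (m : nat) x : staircase x -> x <= m%:R -> A m x.
Proof.
move=> [n [nx Ax]] xm; apply: Amono Ax; rewrite -(ler_nat R).
by apply: ltW; apply: lt_le_trans xm.
Qed.

Lemma staircase_point b : exists x, staircase x /\ b < x.
Proof.
have [|x [Ax /andP[x1 x2]]] := @A_point 0 (Num.max b 1) (Num.max b 1 + 1).
  by rewrite ltrDl.
move: x1; rewrite gt_max => /andP[bx x1].
by exists x; split=> //; exists 1%N.
Qed.

(** Otherwise, compressing [A m.+1] into a far piece of the staircase and going
back into the part up to [m], which is included in [A m], one would map [A m.+1]
into [A m]. *)
Lemma staircase_not_bounded (f : R -> R) c :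
  (forall x, staircase x -> staircase (f x) /\ f x <= c) ->
  ~ (forall x y, staircase x -> staircase y -> x < y -> f x < f y).
Proof.
move=> fX fi; pose m := Num.bound `|c|; pose p : R := m.+2%:R.
(* Beyond [m.+2] the set [A m.+2] is part of the staircase. *)
have [|g gi gA] := A_up m.+1 (_ : p < p + 1); first by rewrite ltrDl.
have gX x : A m.+1 x -> staircase (g x).
  by move=> /gA[Ag /andP[pg _]]; exists m.+2.
apply: (@A_noemb m (f \o g)) => [x y Ax Ay xy|x Ax] /=.
  by apply: fi; [exact: gX|exact: gX|exact: gi].
have [Xf fc] := fX _ (gX _ Ax); apply: staircase_below Xf _.
rewrite (le_trans fc) // (le_trans (ler_norm c)) // ltW //.
exact: archi_boundP (normr_ge0 c).
Qed.

Definition rich (Y : set R) := forall k b, exists (w : R -> R) p q,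
  [/\ increasing w, p < q & forall x, A k x -> p < x < q -> Y (w x) /\ b < w x].

(** The piece of the staircase in [[n, n + 1)] is part of [A n], and [Y] contains
a copy of [A n] to the right of the copies used for the previous pieces. *)
Lemma rich_embeds Y : rich Y -> exists f : R -> R,
  (forall x, staircase x -> Y (f x)) /\
  (forall x y, staircase x -> staircase y -> x < y -> f x < f y).
Proof.
move=> Yr.
have copy (nb : nat * R) : exists gc : (R -> R) * R, [/\ increasing gc.1, nb.2 <= gc.2 &
    forall x, A nb.1 x -> Y (gc.1 x) /\ nb.2 < gc.1 x < gc.2].
  case: nb => n b /=; have [w [p [q [wi pq wY]]]] := Yr n.+1 b.
  have [g gi gA] := A_up n pq.
  exists (w \o g, Num.max b (w q)); split=> /=;
    [exact: increasing_comp|by rewrite le_max lexx|].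
  move=> x /gA[Ag /andP[pg gq]]; have [Yw bw] := wY _ Ag (introT andP (conj pg gq)).
  by split=> //; rewrite bw lt_max (wi _ _ gq) orbT.
have [s sP] := choice copy.
pose u := fix u n := if n is n'.+1 then (s (n', u n')).2 else 0.
have umono m n : (m <= n)%N -> u m <= u n.
  move=> /subnKC <-; elim: (n - m)%N => [|j IH]; rewrite ?addn0 // addnS.
  by apply: le_trans IH _; case: (sP ((m + j)%N, u (m + j)%N)).
pose N (x : R) := Num.trunc x.
have X0 x : staircase x -> 0 <= x by move=> [n [nx _]]; rewrite ltW // (le_lt_trans _ nx).
have XN x : staircase x -> A (N x) x.
  move=> Xx; case: (Xx) => n [nx Ax]; apply: Amono Ax.
  rewrite leqNgt truncn_lt_nat ?X0 // -leNgt ltW //.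
have NM x y : staircase x -> x <= y -> (N x <= N y)%N.
  move=> Xx xy; rewrite leqNgt truncn_lt_nat ?(le_trans (X0 _ Xx)) // -leNgt.
  by apply: le_trans xy; rewrite leNgt -truncn_lt_nat ?X0 // ltnn.
pose f x := (s (N x, u (N x))).1 x.
have fP x : staircase x -> [/\ Y (f x), u (N x) < f x & f x < u (N x).+1].
  by move=> /XN Ax; case: (sP (N x, u (N x))) => _ _ /(_ _ Ax)[? /andP[? ?]].
exists f; split=> [x /fP[]//|x y Xx Xy xy].
move: (NM _ _ Xx (ltW xy)); rewrite leq_eqVlt => /orP[/eqP E|NN].
  by rewrite /f -E; case: (sP (N x, u (N x))) => gi _ _; apply: gi.
have [_ _ fx] := fP _ Xx; have [_ fy _] := fP _ Xy.
by apply: lt_trans fx _; apply: le_lt_trans fy; apply: umono.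
Qed.

Lemma rich_final c : rich [set x | staircase x /\ c < x].
Proof.
move=> k b; pose p := Num.max k%:R (Num.max b c).
exists id, p, (p + 1); split=> //; first by rewrite ltrDl.
move=> x Ax /andP[]; rewrite !gt_max => /andP[kx /andP[bx cx]] _.
by split=> //; split=> //; exists k.
Qed.

(** If [rich] fails for [k] and [b], the dichotomy compresses the part of [Y] beyond
[b] into the interval from [p] to [p + 1] of [A k], with [p] above [b], so that
the part up to [b] need not move, and above [k], so that the interval belongs to
the staircase. *)
Lemma not_rich_bounded Y : Y `<=` staircase -> ~ rich Y -> exists (f : R -> R) z,
  [/\ staircase z, forall y, Y y -> staircase (f y) /\ f y < z &
      forall x y, Y x -> Y y -> x < y -> f x < f y].
Proof.
move=> YX /existsNP[k /existsNP[b nb]].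
have [|[w [p [q [wi pq wY]]]]|small] := A_dich k (Y := [set y | Y y /\ b < y]).
- by move=> y [/YX[n [_ An]] _]; exists n.
- by case: nb; exists w, p, q.
pose p := Num.max k%:R b.
have [|g gi gA] := small p (p + 1); first by rewrite ltrDl.
have [z [Xz pz]] := staircase_point (p + 1).
have bp : b <= p by rewrite le_max lexx orbT.
have kp : k%:R <= p by rewrite le_max lexx.
exists (fun y => if b < y then g y else y), z; split=> //.
  move=> y Yy; have [yb|yb] := leP y b.
    split; first exact: YX.
    by apply: lt_trans pz; rewrite (le_lt_trans (le_trans yb bp)) // ltrDl.
  have [Ag /andP[pg gp]] := gA y (conj Yy yb).
  split; last exact: lt_trans pz.
  by exists k; split=> //; apply: le_lt_trans pg.
move=> x y Yx Yy xy; have [yb|yb] := leP y b.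
  by have [//|bx] := leP x b; have := le_trans (ltW xy) yb; rewrite leNgt bx.
have [xb|xb] := leP x b; last exact: gi.
have [Ag /andP[pg gp]] := gA y (conj Yy yb).
exact: le_lt_trans (le_trans xb bp) pg.
Qed.

Lemma embeds_staircase d (Q : orderType d) (Y : set R) (f : R -> R) (h : Q -> R) :
  (forall x, staircase x -> Y (f x)) ->
  (forall x y, staircase x -> staircase y -> x < y -> f x < f y) ->
  (forall y, Y y -> exists z, h z = y) -> {homo h : x y / (x < y)%O >-> x < y} ->
  embeds (set_type staircase) Q.
Proof.
move=> fY fi hY hi.
have [k kP] := choice (fun x : set_type staircase => hY _ (fY _ (set_valP x))).
exists k => x y xy; rewrite -(leW_mono (le_mono hi)) !kP.
apply: fi; [exact: set_valP|exact: set_valP|].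
by rewrite -lt_val in xy.
Qed.

Lemma osum_ltl d1 (P : orderType d1) d2 (Q : orderType d2) (x y : P) :
  ((inl x : osum P Q) < inl y)%O = (x < y)%O.
Proof. by rewrite !ltNge. Qed.

Lemma osum_ltr d1 (P : orderType d1) d2 (Q : orderType d2) (x y : Q) :
  ((inr x : osum P Q) < inr y)%O = (x < y)%O.
Proof. by rewrite !ltNge. Qed.

Lemma osum_ltlr d1 (P : orderType d1) d2 (Q : orderType d2) (x : P) (y : Q) :
  ((inl x : osum P Q) < inr y)%O.
Proof. by rewrite !ltNge. Qed.

Lemma real_map (e : set_type staircase -> R) :
  exists f : R -> R, forall u, f (set_val u) = e u.
Proof.
have [|f fP] := @choice R R (fun x y => forall u, set_val u = x -> e u = y).
  move=> x; have [[u ux]|nu] := pselect (exists u : set_type staircase, set_val u = x).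
    by exists (e u) => v; rewrite -ux => /val_inj ->.
  by exists 0 => u ux; case: nu; exists u.
by exists f => u; rewrite (fP _ u erefl).
Qed.

Lemma staircase_hagendorf : hagendorf (set_type staircase).
Proof.
have vlt (x y : set_type staircase) : (x < y)%O = (set_val x < set_val y).
  by rewrite -lt_val.
have memX x (Xx : staircase x) : exists u : set_type staircase, set_val u = x.
  by exists (exist _ x (mem_set Xx)).
have Xval (u : set_type staircase) : staircase (set_val u) by exact: set_valP.
split.
- move=> d1 P d2 Q [f [f' ff' f'f] fm] [q0 _].
  have f'm : {mono f' : x y / (x < y)%O} by move=> x y; rewrite -fm !f'f.
  pose x0 := set_val (f' (inr q0)).
  split; first split.
  + by exists (fun p => f' (inl p)) => x y xy; rewrite f'm osum_ltl.
  + move=> [g gi]; have [k kE] := real_map (fun u => set_val (f' (inl (g u)))).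
    apply: (@staircase_not_bounded k x0);
      [move=> x /memX[u <-]|move=> x y /memX[u <-] /memX[v <-]]; rewrite !kE.
      by split; [exact: Xval|rewrite ltW // -vlt f'm osum_ltlr].
    by rewrite -!vlt f'm osum_ltl => /gi.
  + have [k [kY ki]] := rich_embeds (rich_final x0).
    pose h q := set_val (f' (inr q)).
    apply: (embeds_staircase (h := h) kY ki) => [y [/memX[u <-] x0u]|q q' qq'].
      have : (f (f' (inr q0)) < f u)%O by rewrite fm vlt.
      rewrite f'f; case fu : (f u) => [p|q] => [|_]; first by rewrite ltNge.
      by exists q; rewrite /h -fu ff'.
    by rewrite /h -vlt f'm osum_ltr.
- move=> d1 P [[f fi] nXP]; pose h p := set_val (f p).
  have hi : {homo h : x y / (x < y)%O >-> x < y} by move=> x y /fi; rewrite vlt.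
  have nr : ~ rich (range h).
    move=> /rich_embeds[k [kY ki]]; apply: nXP.
    apply: (embeds_staircase (h := h) kY ki) => // y [p _ <-]; by exists p.
  have [|k [z [Xz kX ki]]] := not_rich_bounded _ nr.
    by move=> _ [p _ <-]; apply: Xval.
  have emb (u : osum P 'I_1) : exists v : set_type staircase,
      set_val v = if u is inl p then k (h p) else z.
    case: u => [p|_]; apply: memX => //.
    by have [] := kX (h p) (ex_intro2 _ _ p I erefl).
  have [e eP] := choice emb; exists e => -[p|i] [q|j].
  + rewrite osum_ltl vlt !eP => pq; apply: ki; [by exists p|by exists q|exact: hi].
  + move=> _; rewrite vlt !eP.
    by have [] := kX (h p) (ex_intro2 _ _ p I erefl).
  + by rewrite ltNge.
  + by rewrite osum_ltr !ord1 ltxx.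
- move=> /(_ [pred u | 1 < set_val u])[|m [[m1 mle] _]].
    by have [x [/memX[u <-] x1]] := staircase_point 1; exists u.
  have [x [Ax /andP[x1 xm]]] := A_point 0 m1.
  have /memX[u ux] : staircase x by exists 1%N.
  have : (m <= u)%O by apply: mle; rewrite inE /= ux.
  by rewrite leNgt vlt ux xm.
Qed.

End Hagendorf.

Theorem theorem4p6 (R : realType) (hdiamond : diamond_omega1) :
  exists X : set R, hagendorf (set_type X).
Proof.
have [A [Amono A0 A_noemb A_up A_dich]] := tower_exists R hdiamond.
by exists (staircase A); apply: staircase_hagendorf.
Qed.
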